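(* For every positive integer $n$, let $\zeta=e^{2\pi i/(3n+3)}$. Let $D_n$ be the $n\times n$ matrix whose $(i,j)$-entry is \[\binom{2n+2-i-j}{n-2i+j+1}-\binom{2n+2-i-j}{n+i+j}\] for every $i,j\in\{1,\ldots,n\}$. Then the number of $n$-tuples of non-intersecting lattice paths $(Q_1,\ldots,Q_n)$ that do not go above the line $y=x+n$, with $Q_i$ going from $(2i-2,n-i)$ to $(n+i-1,2n+1-2i)$ for each $i\in\{1,\ldots,n\}$, is \[\det(D_n)=T_n=\prod_{\substack{1\leq a<b\leq 3n+2\\(a,b)\neq(n+1,2n+2)}}\left|1+\zeta^a+\zeta^b\right|^{1/3},\] where the product is over pairs of integers $(a,b)$ and $T_n$ is the number of lozenge tilings of the region $\mathcal{T}_n$.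
   Context: A lattice path is a path in $\mathbb{Z}^2$ each of whose steps is $(1,0)$ or $(0,1)$. A path does not go above $y=x+n$ if every point $(x,y)$ on it satisfies $y\le x+n$. An $n$-tuple of lattice paths is non-intersecting if no two of the paths share a lattice point. Binomial coefficients $\binom{N}{k}$ with $N\ge0$ are $0$ when $k<0$ or $k>N$. Let $\omega=e^{2\pi i/3}$ and consider the triangular grid in the complex plane: the tessellation of $\mathbb{C}$ by equilateral triangles of side length $1$ with vertices in $\mathbb{Z}[\omega]$ (''unit triangles''). The region $\mathcal{T}_n$ is the union of all unit triangles having a vertex at one of the $n(n+1)/2$ points $a(1-\omega)+b(1-\omega^2)$ with integers $a,b\ge 0$, $a+b\le n-1$ (a triangular honeycomb arrangement of $n(n+1)/2$ regular hexagons of side $1$). A lozenge is the union of two unit triangles sharing an edge. A lozenge tiling of $\mathcal{T}_n$ is a set of lozenges contained in $\mathcal{T}_n$ such that each unit triangle of $\mathcal{T}_n$ belongs to exactly one of them. *)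

(* Defs.v *)
From mathcomp Require Import all_boot all_order all_algebra.
From mathcomp Require Import all_classical all_reals all_analysis.
From mathcomp Require Import complex.

Set Implicit Arguments.
Unset Strict Implicit.
Unset Printing Implicit Defensive.

Import Order.TTheory GRing.Theory Num.Theory.

Local Open Scope classical_set_scope.
Local Open Scope ring_scope.

Definition point := (int * int)%type.

Definition lstep : rel point :=
  [rel p q | (q == p + (1, 0)) || (q == p + (0, 1))].

(* A path is the sequence of all the lattice points it visits, in order. *)
Definition lattice_path (A B : point) (s : seq point) : Prop :=
  exists t : seq point, [/\ s = A :: t, path lstep A t & last A t = B].

Definition not_above (n : nat) (s : seq point) : Prop :=
  forall p, p \in s -> p.2 <= p.1 + n%:Z.

Definition nonintersecting (n : nat) (Q : n.-tuple (seq point)) : Prop :=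
  forall i j : 'I_n, i != j ->
    forall p, ~ (p \in tnth Q i /\ p \in tnth Q j).

Definition Qstart (n i : nat) : point := (2 * i%:Z - 2, n%:Z - i%:Z).
Definition Qend (n i : nat) : point :=
  (n%:Z + i%:Z - 1, 2 * n%:Z + 1 - 2 * i%:Z).

(* 'I_n is {0, ..., n-1}, so the index i in {1, ..., n} is i.+1 here. *)
Definition path_tuples (n : nat) : set (n.-tuple (seq point)) :=
  [set Q | [/\ forall i : 'I_n,
                 lattice_path (Qstart n i.+1) (Qend n i.+1) (tnth Q i),
               forall i : 'I_n, not_above n (tnth Q i)
             & nonintersecting Q]].
Arguments path_tuples n : clear implicits.

Definition binz (N : nat) (k : int) : int :=
  if k is Posz m then 'C(N, m)%:Z else 0.

(* i + j <= 2n, so the natural number subtraction is exact. *)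
Definition Dentry (n i j : nat) : int :=
  let N := (2 * n + 2 - (i + j))%N in
  binz N (n%:Z - 2 * i%:Z + j%:Z + 1) - binz N (n%:Z + i%:Z + j%:Z).

Definition Dmx (n : nat) : 'M[int]_n := \matrix_(i, j) Dentry n i.+1 j.+1.

(* The pair (u, v) stands for u + v omega in Z[omega], omega = e^(2 pi i/3);
   only the additive structure is needed, and omega ^ 2 = - 1 - omega. *)
Definition eisenstein := (int * int)%type.
Definition one_eis : eisenstein := (1, 0).
Definition omega : eisenstein := (0, 1).
Definition omega_sq : eisenstein := - one_eis - omega.

(* Since 1 + omega = e^(pi i/3), the unit triangles are, for z in Z[omega],
   the upward ones {z, z + 1, z + 1 + omega}, encoded as (z, true), and the
   downward ones {z, z + omega, z + 1 + omega}, encoded as (z, false). *)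
Definition triangle := (eisenstein * bool)%type.

Definition vertices (t : triangle) : seq eisenstein :=
  let z := t.1 in
  if t.2 then [:: z; z + one_eis; z + one_eis + omega]
  else [:: z; z + omega; z + one_eis + omega].

(* Two unit triangles share an edge iff they have exactly two common vertices. *)
Definition share_edge (t t' : triangle) : bool :=
  count [in vertices t'] (vertices t) == 2.

(* A union of unit triangles is represented by the set of these triangles. *)
Definition region (n : nat) : set triangle :=
  [set t | exists a b : nat, (a + b <= n.-1)%N /\
     (one_eis - omega) *+ a + (one_eis - omega_sq) *+ b \in vertices t].

Definition lozenge (L : set triangle) : Prop :=
  exists t t', share_edge t t' /\ L = [set t; t'].

Definition lozenge_tilings (n : nat) : set (set (set triangle)) :=
  [set S | (forall L, S L -> lozenge L /\ L `<=` region n) /\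
           (forall t, region n t -> exists! L, S L /\ L t)].

Definition zeta (R : realType) (n : nat) : R[i] :=
  let theta := 2 * pi / (3 * n + 3)%:R in Complex (cos theta) (sin theta).

Definition modulus (R : realType) (z : R[i]) : R := ComplexField.Normc.normc z.

(* Main.v *)
Require Import Defs.
From mathcomp Require Import all_boot all_order all_algebra.
From mathcomp Require Import all_fingroup.
From mathcomp Require Import all_classical all_reals all_analysis.
From mathcomp Require Import complex.
From mathcomp Require Import ring lra zify.

(**
  Lozenge tilings are perfect matchings between the downward and the upward unit
  triangles. With N = 3n+3, the triangles are points with positive integer
  barycentric coordinates of sum N, that is, 3-subsets of Z/N up to translation, and
  adjacency becomes "one of the three elements decreases by 1".

  Product formula. On all 3-subsets up to translation this operator M is normal:
  its eigenvectors are Slater determinants of characters, with eigenvalues of modulus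
  |1 + zeta^a + zeta^b|. It permutes cyclically three colour classes, two of which
  are the triangles, and by normality the three blocks of M M^* have the same
  spectrum up to the eigenvalue 0. Hence det K ^ 6 = prod |1 + zeta^a + zeta^b|^2
  for the biadjacency matrix K of the triangles, where the pair (n+1, 2n+2) accounts
  for the eigenvalue 0.

  Counting. The lozenges without a horizontal middle edge form non-intersecting
  lattice paths, and a matching becomes a permutation of the horizontal edges whose
  nontrivial cycles are the paths closed up. Planarity forces the i-th path to end
  at the i-th end point, so these cycles have odd length and every term of det K is
  positive. The reflection principle inverts the unitriangular part of K and
  expresses det K as det D_n.
*)

Set Implicit Arguments.
Unset Strict Implicit.
Unset Printing Implicit Defensive.

Import Order.TTheory GRing.Theory Num.Theory.

Local Open Scope classical_set_scope.
Local Open Scope card_scope.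
Local Open Scope ring_scope.

(** * Matrices indexed by finite types *)

Definition mxf (R : Type) (I J : finType) (f : I -> J -> R) : 'M[R]_(#|I|, #|J|) :=
  \matrix_(i, j) f (enum_val i) (enum_val j).

Lemma eq_mxf (R : Type) (I J : finType) (f g : I -> J -> R) :
  f =2 g -> mxf f = mxf g.
Proof. by move=> fg; apply/matrixP => i j; rewrite !mxE fg. Qed.

Lemma mxf_tr (R : Type) (I J : finType) (f : I -> J -> R) :
  (mxf f)^T = mxf (fun j i => f i j).
Proof. by apply/matrixP => i j; rewrite !mxE. Qed.

Lemma mulmx_mxf (R : pzSemiRingType) (I J K : finType)
    (f : I -> J -> R) (g : J -> K -> R) :
  mxf f *m mxf g = mxf (fun i k => \sum_j f i j * g j k).
Proof.
apply/matrixP => i k; rewrite !mxE [RHS](reindex _ (onW_bij _ (enum_val_bij J))).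
by apply: eq_bigr => j _; rewrite !mxE.
Qed.

Lemma mxfD (R : nmodType) (I J : finType) (f g : I -> J -> R) :
  mxf f + mxf g = mxf (fun i j => f i j + g i j).
Proof. by apply/matrixP => i j; rewrite !mxE. Qed.

Lemma mxf_diag (R : pzSemiRingType) (I : finType) (d : I -> R) :
  mxf (fun i j => d i *+ (i == j)) = diag_mx (\row_i d (enum_val i)).
Proof.
by apply/matrixP => i j; rewrite !mxE (inj_eq enum_val_inj) eq_sym.
Qed.

Lemma mxf_scalar (R : pzSemiRingType) (I : finType) (a : R) :
  mxf (fun i j : I => a *+ (i == j)) = a%:M.
Proof.
by apply/matrixP => i j; rewrite !mxE (inj_eq enum_val_inj).
Qed.

(** The sign is a homomorphism to a group of order 2, so for odd [m] the sign of [s ^+ m = 1] is the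
    sign of [s]. *)
Lemma odd_perm_odd_order (I : finType) (s : {perm I}) (m : nat) :
  odd m -> (forall x, iter m s x = x) -> odd_perm s = false.
Proof.
move=> om sm; have e : (s ^+ m = 1)%g.
  by apply/permP => x; rewrite permX sm perm1.
have : odd_perm (s ^+ m)%g = odd_perm s.
  rewrite -(odd_double_half m) om expgD expg1 -mul2n expgM odd_permM.
  have /= -> : odd_perm ((s ^+ 2) ^+ m./2)%g = false.
    elim: (m./2) => [|k IH]; first by rewrite expg0 odd_perm1.
    by rewrite expgS odd_permM IH expgS expg1 odd_permM addbb.
  by rewrite addbF.
by rewrite e odd_perm1.
Qed.

Lemma prodr_bool (R : comPzSemiRingType) (I : finType) (P : pred I) :
  \prod_x (P x)%:R = [forall x, P x]%:R :> R.
Proof.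
case: forallP => [h|/forallP]; first by apply: big1 => x _; rewrite h.
by rewrite negb_forall => /existsP[x /negPf hx]; rewrite (bigD1 x) //= hx mul0r.
Qed.

(* Every permutation contributing to the determinant is even, being of odd order. *)
Lemma det_mxf_rel (R : comPzRingType) (I : finType) (r : rel I) :
  (forall s : {perm I}, (forall x, r x (s x)) ->
     exists2 m, odd m & forall x, iter m s x = x) ->
  \det (mxf (fun x y => (r x y)%:R : R)) =
    #|[set s : {perm I} | [forall x, r x (s x)]]%SET|%:R.
Proof.
move=> hodd.
pose lo (f : 'S_#|I|) : {perm I} :=
  perm (inj_comp (inj_comp enum_val_inj (@perm_inj _ f)) (@enum_rank_inj I)).
have loE f x : lo f x = enum_val (f (enum_rank x)) by rewrite permE.
pose up (s : {perm I}) : 'S_#|I| :=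
  perm (inj_comp (inj_comp enum_rank_inj (@perm_inj _ s)) enum_val_inj).
have upE s i : up s i = enum_rank (s (enum_val i)) by rewrite permE.
have loK : cancel lo up.
  by move=> f; apply/permP => i; rewrite upE loE !enum_valK.
have upK : cancel up lo.
  by move=> s; apply/permP => i; rewrite loE upE !enum_rankK.
rewrite -sum1_card natr_sum /determinant.
rewrite [RHS](reindex lo); last by exists up => ? _.
rewrite [RHS]big_mkcond; apply: eq_bigr => f _.
under eq_bigr do rewrite mxE.
rewrite (prodr_bool _ (fun i => r (enum_val i) (enum_val (f i)))).
have -> : [forall i, r (enum_val i) (enum_val (f i))] = (lo f \in [set s : {perm I} |
  [forall x, r x (s x)]]%SET).
  rewrite inE; apply/forallP/forallP => h x.
    by have := h (enum_rank x); rewrite loE enum_rankK.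
  by have := h (enum_val x); rewrite loE enum_valK.
case: ifP => [|_]; last by rewrite mulr0.
rewrite inE => /forallP/hodd[m om hm].
rewrite (@odd_perm_odd_order _ f m) ?expr0 ?mulr1 //.
move=> i; apply: enum_val_inj.
have : forall k, enum_val (iter k f i) = iter k (lo f) (enum_val i).
  by elim=> //= k IH; rewrite -IH loE enum_valK.
by move=> ->; rewrite hm.
Qed.

(** Two block eliminations of the same matrix [Z]. No division occurs, so [t] may be a polynomial
    variable or 1. *)
Lemma sylvester (R : comPzRingType) (m k : nat) (t : R)
    (A : 'M[R]_(m, k)) (B : 'M[R]_(k, m)) :
  t ^+ k * \det (t%:M + A *m B) = t ^+ m * \det (t%:M + B *m A).
Proof.
pose Z := block_mx t%:M (- A) B (1%:M : 'M[R]_k).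
have hZ : \det Z = \det (t%:M + A *m B).
  have : \det (Z *m block_mx (1%:M : 'M[R]_m) 0 (- B) (1%:M : 'M[R]_k)) = \det (t%:M
    + A *m B).
    rewrite mulmx_block !mulmx1 !mulmx0 mulNmx mulmxN opprK mul1mx subrr !add0r.
    by rewrite det_ublock det1 mulr1.
  by rewrite det_mulmx det_lblock !det1 !mulr1.
have : \det (block_mx (1%:M : 'M[R]_m) 0 (- B) (t%:M : 'M[R]_k) *m Z) = t ^+ m * \det
  (t%:M + B *m A).
  rewrite mulmx_block !mul1mx !mul0mx !addr0 mulmx1 mulmxN [- B *m A]mulNmx opprK.
  by rewrite mulNmx scalar_mxC addNr det_ublock det_scalar [B *m A + _]addrC.
by rewrite det_mulmx det_lblock det1 mul1r det_scalar hZ => ->.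
Qed.

(** * A spectral formula for a determinant *)

Section ThreeColors.
Variables (R : idomainType) (m : nat) (t : R) (M N P Q S : 'M[R]_m).
Hypothesis t0 : t != 0.
Hypothesis comm : M *m N = N *m M.
Hypotheses (PP : P *m P = P) (QQ : Q *m Q = Q).
Hypotheses (PQ : P *m Q = 0) (PS : P *m S = 0) (QS : Q *m S = 0).
Hypothesis PQS : P + Q + S = 1%:M.
Hypotheses (MQ : M *m Q = P *m M) (MS : M *m S = Q *m M).
Hypotheses (NP : N *m P = Q *m N) (NQ : N *m Q = S *m N).

(** [A (M N)] factors as [(A M) (N A)], and swapping the factors by [sylvester] gives
    [N A M = B N M = B (M N)]. *)
Lemma det_color_shift (A B : 'M[R]_m) : A *m A = A -> M *m B = A *m M -> 
  N *m A = B *m N ->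
  \det (t%:M + A *m (M *m N)) = \det (t%:M + B *m (M *m N)).
Proof.
move=> AA MB NA.
have -> : A *m (M *m N) = (A *m M) *m (N *m A).
  by rewrite NA (mulmxA (A *m M)) -(mulmxA A M B) MB (mulmxA A A) AA mulmxA.
apply: (mulfI (expf_neq0 m t0)); rewrite sylvester.
by rewrite -(mulmxA N) (mulmxA A A) AA (mulmxA N) NA -mulmxA -comm.
Qed.

(* Normality makes [t + P M N], [t + Q M N] and [t + S M N] have the same
   determinant, and their product is [t ^ 2 (t + M N)]. *)
Lemma det_three_colors :
  \det (t%:M + P *m (M *m N)) ^+ 3 = t ^+ (2 * m) * \det (t%:M + M *m N).
Proof.
set H := M *m N.
have HP : H *m P = P *m H by rewrite /H -mulmxA NP mulmxA MQ mulmxA.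
have HQ : H *m Q = Q *m H by rewrite /H -mulmxA NQ mulmxA MS mulmxA.
have eQ : \det (t%:M + P *m H) = \det (t%:M + Q *m H) by apply: det_color_shift.
have eS : \det (t%:M + Q *m H) = \det (t%:M + S *m H) by apply: det_color_shift.
have -> : \det (t%:M + P *m H) ^+ 3 =
    \det ((t%:M + P *m H) *m ((t%:M + Q *m H) *m (t%:M + S *m H))).
  by rewrite !det_mulmx -eS -eQ !exprS expr0 mulr1.
have -> : (t%:M + P *m H) *m ((t%:M + Q *m H) *m (t%:M + S *m H)) =
   (t ^+ 2)%:M *m (t%:M + (P + Q + S) *m H).
  (* [H] commutes with [P] and [Q], so the cross terms between different colours vanish. *)
  rewrite !(mulmxDl, mulmxDr) -!scalar_mxM ?mul_scalar_mx ?mul_mx_scalar.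
  have z1 : Q *m H *m (S *m H) = 0 by rewrite -HQ -mulmxA (mulmxA Q) QS mul0mx mulmx0.
  have z2 : P *m H *m (S *m H) = 0 by rewrite -HP -mulmxA (mulmxA P) PS mul0mx mulmx0.
  have z3 : P *m H *m (Q *m H) = 0 by rewrite -HP -mulmxA (mulmxA P) PQ mul0mx mulmx0.
  rewrite z1 mulmx0 -!scalemxAr z2 z3 !scaler0 !addr0 !scalerA expr2 -mulrA -!addrA.
  by congr (_ + _); rewrite addrA addrC (addrC (_ *: (S *m H))).
by rewrite det_mulmx PQS mul1mx det_scalar exprM.
Qed.
End ThreeColors.

(** * The sixth power of a determinant as a product of eigenvalues, in abstract form *)

Section DetSpectral.
Variables (C : fieldType) (k m : nat).
Variables (M F P Q S : 'M[C]_m) (l1 l2 : 'I_m -> C) (i0 : 'I_m).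
Variables (I1 I2 : 'M[C]_(k, m)) (G : 'M[C]_k) (beta : pred 'I_k).
Let N := M^T.
Let B : 'M[C]_k := diag_mx (\row_i (beta i)%:R).
Hypotheses (Fu : F \in unitmx).
Hypothesis MF : M *m F = F *m diag_mx (\row_i l1 i).
Hypothesis NF : N *m F = F *m diag_mx (\row_i l2 i).
Hypotheses (tP : P^T = P) (tQ : Q^T = Q) (tS : S^T = S).
Hypotheses (PP : P *m P = P) (QQ : Q *m Q = Q).
Hypotheses (PQ : P *m Q = 0) (PS : P *m S = 0) (QS : Q *m S = 0).
Hypothesis PQS : P + Q + S = 1%:M.
Hypotheses (MQ : M *m Q = P *m M) (MS : M *m S = Q *m M).
Hypotheses (I1t : I1 *m I1^T = 1%:M - B) (tI1 : I1^T *m I1 = P) (BI1 : B *m I1 = 0).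
Hypotheses (tI2 : I2^T *m I2 = Q) (GI2 : G *m I2 = 0) (GG : G *m G^T = B).
Hypothesis card : (m + 3 * #|beta| = 3 * k + 1)%N.
Hypothesis l0 : l1 i0 * l2 i0 = 0.

Let L : 'M[C]_m := diag_mx (\row_i (l1 i * l2 i)).

Let MNF : M *m N *m F = F *m L.
Proof.
rewrite -mulmxA NF mulmxA MF -mulmxA mulmx_diag; congr (_ *m diag_mx _).
by apply/rowP => i; rewrite !mxE.
Qed.

Let comm : M *m N = N *m M.
Proof.
apply: (can_inj (mulmxK Fu)); rewrite MNF -mulmxA MF mulmxA NF -mulmxA mulmx_diag.
by congr (_ *m diag_mx _); apply/rowP => i; rewrite !mxE mulrC.
Qed.

(** The block of [M] between the colours [P] and [Q], reindexed by the partial isometries [I1] and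
    [I2]. The rows in [beta], which [I1] kills, are supplied by [G]. *)
Let K := I1 *m M *m I2^T + G.

Let I1P : I1 *m P = I1.
Proof. by rewrite -tI1 mulmxA I1t mulmxBl mul1mx BI1 subr0. Qed.

Let NP : N *m P = Q *m N.
Proof. by rewrite -{1}tP -trmx_mul -MQ trmx_mul tQ. Qed.
Let NQ : N *m Q = S *m N.
Proof. by rewrite -{1}tQ -trmx_mul -MS trmx_mul tS. Qed.

Let KK : K *m K^T = I1 *m (M *m N) *m I1^T + B.
Proof.
rewrite linearD /= !trmx_mul trmxK mulmxDl !mulmxDr GG.
have -> : I1 *m M *m I2^T *m G^T = 0.
  by rewrite -mulmxA -trmx_mul GI2 trmx0 mulmx0.
rewrite (mulmxA G) GI2 mul0mx add0r addr0; congr (_ + _).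
rewrite -/N -!mulmxA (mulmxA I2^T) tI2 (mulmxA M) MQ -!mulmxA (mulmxA I1 P) I1P.
by rewrite !mulmxA.
Qed.

(* All determinants are compared as polynomials in [X]; the factors [X] cancel
   because of [card], and [X = 0] gives the result. *)
Let X : {poly C} := 'X.
Let H : 'M[{poly C}]_m := map_mx polyC (M *m N).
Let r : {poly C} := \det (X *: (1%:M - map_mx polyC B) + map_mx polyC (K *m K^T)).

Let det_r : X ^+ (m + #|beta|) * r = X ^+ k * \det (X%:M + map_mx polyC P *m H).
Proof.
pose J : 'M[{poly C}]_(k, m) := map_mx polyC I1.
have -> : map_mx polyC P = J^T *m J by rewrite -tI1 map_mxM map_trmx.
rewrite -mulmxA sylvester.
rewrite exprD -mulrA; congr (_ * _).
pose B' : 'M[{poly C}]_k := map_mx polyC B.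
have B'E : B' = diag_mx (\row_i (beta i)%:R).
  by rewrite /B' map_diag_mx; congr diag_mx; apply/rowP => i; rewrite !mxE rmorph_nat.
(* Multiplying by [1 - B' + X B'] completes [X (1 - B') + B'] to the scalar [X], at the cost of a
   factor [X ^+ #|beta|]. *)
have detB : \det (1%:M - B' + X *: B') = X ^+ #|beta|.
  have -> : 1%:M - B' + X *: B' = diag_mx (\row_i (if beta i then X else 1)).
    rewrite B'E; apply/matrixP => i j; rewrite !mxE.
    case: (i == j); rewrite ?mulr1n ?mulr0n ?mulr0 ?subr0 ?addr0 //.
    by case: (beta i); rewrite ?mulr1 ?mulr0 ?subr0 ?addr0 ?subrr ?add0r.
  rewrite det_diag; under eq_bigr do rewrite mxE.
  by rewrite -big_mkcond prodr_const.
have BB : B' *m B' = B'.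
  rewrite B'E mulmx_diag; congr diag_mx; apply/rowP => i; rewrite !mxE.
  by rewrite -natrM mulnb andbb.
have BI : B' *m J = 0 by rewrite -map_mxM BI1 map_mx0.
rewrite -detB /r -det_mulmx; congr (\det _).
rewrite KK map_mxD -/B' (map_mxM polyC (_ *m _)) (map_mxM polyC I1) /= -/H -/J
  -map_trmx -/J.
set Y := _ *m _ *m _.
have BY : B' *m Y = 0 by rewrite /Y !mulmxA BI !mul0mx.
move: (B') (Y) BB BY => E Z EE EZ.
rewrite !(mulmxDl, mulmxDr, mulNmx, mulmxN, mul1mx, mulmx1, scalerDr, scalerN).
rewrite -!(scalemxAl, scalemxAr) !(mulmxDl, mulmxDr, mulNmx, mulmxN, mul1mx, mulmx1,
  scalerDr, scalerN, EE, EZ, scaler0).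
rewrite !subrr ?scaler0 ?addr0 ?subrr ?oppr0 ?addr0 ?scalemx1.
by rewrite !add0r addrA addrK addrAC subrK.
Qed.

Let det_H : \det (X%:M + H) = \prod_i (X + (l1 i * l2 i)%:P).
Proof.
pose F' : 'M[{poly C}]_m := map_mx polyC F.
have F'0 : \det F' != 0.
  by rewrite det_map_mx polyC_eq0 -unitfE -unitmxE.
apply: (mulIf F'0); rewrite -det_mulmx mulmxDl -map_mxM MNF map_mxM.
rewrite -scalar_mxC -mulmxDr det_mulmx mulrC; congr (_ * _).
have -> : X%:M + map_mx polyC L = diag_mx (\row_i (X + (l1 i * l2 i)%:P)).
  apply/matrixP => i j; rewrite !mxE.
  by case: (i == j); rewrite ?mulr1n ?mulr0n ?addr0.
by rewrite det_diag; apply: eq_bigr => i _; rewrite mxE.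
Qed.

Let det_PH : \det (X%:M + map_mx polyC P *m H) ^+ 3 = X ^+ (2 * m) * \det (X%:M + H).
Proof.
rewrite /H map_mxM /=.
apply: (@det_three_colors _ _ X _ _ _ (map_mx polyC Q) (map_mx polyC S));
  rewrite -?map_mxM -?map_mxD ?comm ?PP ?QQ ?PQ ?PS ?QS ?PQS ?map_mx0 ?map_mx1
    ?MQ ?MS ?NP ?NQ //.
by rewrite polyX_eq0.
Qed.

Lemma det_spectral : \det K ^+ 6 = \prod_(i | i != i0) (l1 i * l2 i).
Proof.
have X0 : X != 0 by rewrite polyX_eq0.
have e : r ^+ 3 = \prod_(i | i != i0) (X + (l1 i * l2 i)%:P).
  apply: (mulfI (expf_neq0 (3 * (m + #|beta|)) X0)).
  have -> : X ^+ (3 * (m + #|beta|)) * r ^+ 3 = (X ^+ (m + #|beta|) * r) ^+ 3.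
    by rewrite exprMn -exprM mulnC.
  (* The eigenvalue 0 at [i0] gives one more factor [X]; by [card] the exponents agree:
     [3 (m + #|beta|) = 3 k + 2 m + 1]. *)
  rewrite det_r exprMn det_PH det_H (bigD1 i0) //= l0 polyC0 addr0 !mulrA.
  by rewrite -exprM -!exprD -exprSr; congr (X ^+ _ * _); lia.
have := congr1 (fun p => p.[0]) e.
rewrite horner_exp horner_prod.
have -> : r.[0] = \det K ^+ 2.
  rewrite /r -horner_evalE -det_map_mx.
  have -> : map_mx (horner_eval (0 : C)) (X *: (1%:M - map_mx polyC B) + map_mx polyC
    (K *m K^T)) = K *m K^T.
    by apply/matrixP => i j; rewrite !mxE /= /horner_eval hornerD hornerM hornerX
      mul0r add0r hornerC.
  by rewrite det_mulmx det_tr expr2.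
rewrite -exprM => ->; apply: eq_bigr => i _.
by rewrite hornerD hornerX add0r hornerC.
Qed.
End DetSpectral.

(** * Slater determinants on the alcove *)

(* With N = 3n+3, a point (a, b) is a 3-subset {0 < a < b} of Z/N up to
   translation, that is, a point of the plane with positive barycentric coordinates
   (a, b - a, N - b). Those with a + b = 2, 1, 0 mod 3 are the downward triangles,
   the upward triangles and (for the most part) grid vertices, respectively. *)
Definition alcove (n : nat) :=
  {p : 'I_(3 * n + 3) * 'I_(3 * n + 3) | (0 < p.1 < p.2)%N}.
Definition pa n (p : alcove n) : nat := (val p).1.
Definition pb n (p : alcove n) : nat := (val p).2.

Lemma alcove_inj n (p q : alcove n) : pa p = pa q -> pb p = pb q -> p = q.
Proof.
case: p q => [[a b] h] [[a' b'] h']; rewrite /pa /pb /= => e e'.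
by apply: val_inj; congr pair; apply: val_inj.
Qed.

Lemma alcoveP n (p : alcove n) : (0 < pa p < pb p)%N /\ (pb p < 3 * n + 3)%N.
Proof. by split; [apply: (valP p)|apply: ltn_ord]. Qed.

Lemma alcove_ex n (a b : nat) : (0 < a < b)%N -> (b < 3 * n + 3)%N ->
  {p : alcove n | pa p = a & pb p = b}.
Proof.
move=> /andP[a0 ab] bN; have aN := ltn_trans ab bN.
have h : (0 < (Ordinal aN, Ordinal bN).1 < (Ordinal aN, Ordinal bN).2)%N.
  by rewrite /= a0.
by exists (Sub (Ordinal aN, Ordinal bN) h).
Qed.

(* One of the three elements of the subset decreases by 1; for the element 0
   this is the third case, after a translation. From a downward triangle, these
   are the moves to the adjacent upward triangles. *)
Definition pmove n (p q : alcove n) : bool :=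
  [|| ((pa q).+1 == pa p) && (pb q == pb p),
      (pa q == pa p) && ((pb q).+1 == pb p) |
      (pa q == (pa p).+1) && (pb q == (pb p).+1)].

Lemma big_sig (R : Type) (idx : R) (op : Monoid.com_law idx) (I : finType)
    (A : pred I) (F : I -> R) :
  \big[op/idx]_(i | A i) F i = \big[op/idx]_(x : {x | A x}) F (val x).
Proof.
rewrite (reindex_omap (val : {x | A x} -> I) insub); last first.
  by move=> i Ai; rewrite insubT.
by apply: eq_bigl => x; rewrite valK eqxx (valP x).
Qed.

Section SumAlcove.
Variables (n : nat).
Local Notation N := (3 * n + 3)%N.

Lemma sum_alcove_delta (R : pzSemiRingType) (f : nat -> nat -> R) (x y : nat) :
  \sum_(p : alcove n) ((pa p == x) && (pb p == y))%:R * f (pa p) (pb p) =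
  if (0 < x < y)%N && (y < N)%N then f x y else 0.
Proof.
case: ifP => [/andP[h1 h2]|h].
  have [p px py] := alcove_ex h1 h2.
  rewrite (bigD1 p) //= px py !eqxx mul1r big1 ?addr0 // => q qp.
  case: andP => [[/eqP ex /eqP ey]|]; last by rewrite mul0r.
  by case/negP: qp; apply/eqP/alcove_inj; rewrite ?px ?py.
apply: big1 => p _; case: andP => [[/eqP ex /eqP ey]|]; last by rewrite mul0r.
by move: h; have [] := alcoveP p; rewrite ex ey => -> ->.
Qed.

(** Passes to a full square, where the sums over [x] and [y] separate: the alcove [0 < x < y] and
    its mirror image contain the support of [h]. *)
Lemma sum_alcove_torus (R : nmodType) (h : nat -> nat -> R) :
  (forall x y, h x y = h y x) -> (forall x, h x x = 0) -> (forall y, h 0%N y = 0) ->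
  \sum_(x < N) \sum_(y < N) h x y = (\sum_(p : alcove n) h (pa p) (pb p)) *+ 2.
Proof.
move=> hC hd h0.
have -> : \sum_(p : alcove n) h (pa p) (pb p) =
    \sum_(x < N) \sum_(y < N | (0 < x < y)%N) h x y.
  rewrite pair_big_dep /=.
  by rewrite (big_sig _ (fun p : 'I_N * 'I_N => 0 < p.1 < p.2)%N (fun p => h p.1 p.2)).
rewrite mulr2n [X in _ + X](_ : _ = \sum_(x < N) \sum_(y < N | (0 < y < x)%N) h x y);
  last first.
  rewrite (exchange_big_dep predT) //=; apply: eq_bigr => x _.
  by apply: eq_bigr => y _; rewrite hC.
rewrite -big_split /=; apply: eq_bigr => x _.
rewrite big_mkcond [X in _ = X + _]big_mkcond [X in _ = _ + X]big_mkcond -big_split /=.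
apply: eq_bigr => y _.
have [x0|x0] := posnP x; first by rewrite x0 h0 andbF addr0.
have [y0|y0] := posnP y; first by rewrite y0 hC h0 andbF addr0.
rewrite /=; case: (ltngtP x y) => [||xy]; rewrite ?addr0 ?add0r //.
by rewrite xy hd.
Qed.
End SumAlcove.

Section Slater.
Variable R : comPzRingType.

(* The determinant of the rows (t_k^0, t_k^x, t_k^y), k = 0, 1, 2. *)
Definition slater (t : nat -> R) (x y : nat) : R :=
  (t 1%N ^+ x * t 2%N ^+ y - t 2%N ^+ x * t 1%N ^+ y)
  + (t 2%N ^+ x * t 0%N ^+ y - t 0%N ^+ x * t 2%N ^+ y)
  + (t 0%N ^+ x * t 1%N ^+ y - t 1%N ^+ x * t 0%N ^+ y).

(** For [k, l < 3], the sign of the permutation of [{0, 1, 2}] that starts with [k, l], and 0 if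
    [k = l]. *)
Definition eps3 (k l : nat) : R := (l == k.+1 %% 3)%N%:R - (k == l.+1 %% 3)%N%:R.

Lemma slaterE t x y :
  slater t x y = \sum_(k < 3) \sum_(l < 3) eps3 k l * (t k ^+ x * t l ^+ y).
Proof.
rewrite !big_ord_recl !big_ord0 /= /bump /= /eps3 /= /slater.
ring.
Qed.

Variable t : nat -> R.

Lemma slaterC x y : slater t x y = - slater t y x.
Proof. by rewrite /slater; ring. Qed.

Lemma slater_diag x : slater t x x = 0.
Proof. by rewrite /slater; ring. Qed.

Lemma slater0 y : slater t 0%N y = 0.
Proof. by rewrite /slater; ring. Qed.

Hypothesis t1 : t 0%N * t 1%N * t 2%N = 1.

(** Lowering the exponent of one row and summing over the three rows multiplies the determinant by
    the sum of the [t_k^-1], which is the second symmetric function since the product is 1. Lowering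
    the row of exponent 0 amounts to raising the other two. *)
Lemma slater_down x y :
  slater t x y.+1 + slater t x.+1 y + slater t x.+2 y.+2 =
  (t 1%N * t 2%N + t 0%N * t 2%N + t 0%N * t 1%N) * slater t x.+1 y.+1.
Proof.
rewrite -[slater t x y.+1]mul1r -[slater t x.+1 y]mul1r -t1 /slater !exprS; ring.
Qed.

Lemma slater_up x y :
  slater t x.+2 y.+1 + slater t x.+1 y.+2 + slater t x y =
  (t 0%N + t 1%N + t 2%N) * slater t x.+1 y.+1.
Proof.
rewrite -[slater t x y]mul1r -t1 /slater !exprS; ring.
Qed.

(** The subset [{0, x, y}] is translated by [-x]; replacing the exponent [-x] by [N - x] costs
    [kappa], and the cyclic permutation of the rows is even. *)
Lemma slater_rot N x y kappa : (x <= y)%N -> (x <= N)%N ->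
  (forall k, (k < 3)%N -> t k ^+ N = kappa) ->
  slater t (y - x) (N - x) = kappa * slater t x y.
Proof.
move=> xy xN tN.
have h k k1 k2 : (k < 3)%N -> t k * (t k1 * t k2) = 1 ->
    t k ^+ (N - x) = kappa * (t k1 ^+ x * t k2 ^+ x).
  move=> k3 e; rewrite -(tN k k3) -{2}(subnK xN) exprD -mulrA -exprMn -exprMn e.
  by rewrite expr1n mulr1.
rewrite /slater (h 0 1 2)%N ?(h 1 0 2)%N ?(h 2 0 1)%N //; first last.
- by rewrite -t1; ring.
- by rewrite -t1; ring.
- by rewrite -t1; ring.
have E k : t k ^+ y = t k ^+ (y - x) * t k ^+ x by rewrite -exprD subnK.
by rewrite !E; ring.
Qed.

(** The row of exponent [N] is constant, hence proportional to the row of exponent 0. *)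
Lemma slater_end N x kappa : (forall k, (k < 3)%N -> t k ^+ N = kappa) ->
  slater t x N = 0.
Proof. by move=> tN; rewrite /slater !tN //; ring. Qed.

Lemma slater_torus N (s : nat -> R) :
  \sum_(x < N) \sum_(y < N) slater t x y * slater s x y =
  \sum_(k < 3) \sum_(l < 3) \sum_(k' < 3) \sum_(l' < 3)
    eps3 k l * eps3 k' l' *
      ((\sum_(x < N) (t k * s k') ^+ x) * (\sum_(y < N) (t l * s l') ^+ y)).
Proof.
have E x y : slater t x y * slater s x y =
    \sum_(k < 3) \sum_(l < 3) \sum_(k' < 3) \sum_(l' < 3)
    eps3 k l * eps3 k' l' * ((t k * s k') ^+ x * (t l * s l') ^+ y).
  rewrite !slaterE !big_distrl /=; apply: eq_bigr => k _.
  rewrite !big_distrl /=; apply: eq_bigr => l _.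
  rewrite !big_distrr /=; apply: eq_bigr => k' _.
  rewrite !big_distrr /=; apply: eq_bigr => l' _.
  by rewrite !exprMn; ring.
under eq_bigr do (under eq_bigr do rewrite E).
rewrite pair_bigA /=.
do 4! (rewrite exchange_big /=; apply: eq_bigr => ? _).
rewrite -big_distrr /= big_distrlr /= pair_bigA; congr (_ * _).
Qed.
End Slater.

Definition triple (a b k : nat) : nat :=
  if k is k'.+1 then (if k' is _.+1 then b else a) else 0.

(* The shift by [a + b] makes the exponents of the three frequencies sum to 0, so
   that their product is 1 and the Slater determinant is translation invariant. *)
Definition expo (a b k : nat) : int := 3 * (triple a b k)%:Z - (a + b)%:Z.

Lemma expo_sum a b : expo a b 0 + expo a b 1 + expo a b 2 = 0.
Proof. by rewrite /expo /=; lia. Qed.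

Lemma small_multiples (N q1 q2 : int) : 0 < N ->
  `|N * q1 - N * q2| < 2 * N -> `|2 * (N * q1) + N * q2| < 2 * N ->
  `|N * q1 + 2 * (N * q2)| < 2 * N -> q1 = 0 /\ q2 = 0.
Proof.
move=> N0 h1 h2 h3.
have b (q : int) : `|N * q| < 2 * N -> `|q| < 2.
  by rewrite normrM gtr0_norm // [2 * N]mulrC ltr_pM2l.
have {}h1 : `|q1 - q2| < 2 by apply: b; rewrite mulrBr.
have {}h2 : `|2 * q1 + q2| < 2 by apply: b; rewrite mulrDr mulrCA.
have {}h3 : `|q1 + 2 * q2| < 2 by apply: b; rewrite mulrDr [N * (2 * _)]mulrCA.
lia.
Qed.

(** Exponents of a subset sum to 0, so the two congruences give a third one. Differences between the
    three discrepancies, divided by 3, are differences of gaps between elements, hence below [2 N],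
    and [small_multiples] makes the discrepancies 0. The order [0 < a < b] then identifies the
    indices. *)
Lemma expo_sep (N a b a' b' k l k' l' : nat) :
  (0 < a < b)%N -> (b < N)%N -> (0 < a' < b')%N -> (b' < N)%N ->
  (k < 3)%N -> (l < 3)%N -> (k' < 3)%N -> (l' < 3)%N -> k <> l -> k' <> l' ->
  ((3 * N)%:Z %| expo a b k - expo a' b' k')%Z ->
  ((3 * N)%:Z %| expo a b l - expo a' b' l')%Z ->
  [/\ a = a', b = b', k = k' & l = l'].
Proof.
move=> h1 h2 h3 h4 k3 l3 k3' l3' kl kl' /dvdzP[q1 e1] /dvdzP[q2 e2].
have N0 : 0 < N%:Z :> int by lia.
have {}e1 : expo a b k - expo a' b' k' = 3 * (N%:Z * q1) by rewrite e1 PoszM; ring.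
have {}e2 : expo a b l - expo a' b' l' = 3 * (N%:Z * q2) by rewrite e2 PoszM; ring.
have [q10 q20] : q1 = 0 /\ q2 = 0.
  apply: (@small_multiples N%:Z) => //; move: (N%:Z * q1) (N%:Z * q2) e1 e2 => u v.
  - case: k k3 kl => [|[|[|//]]] _; case: l l3 => [|[|[|//]]] _ // _;
      case: k' k3' kl' => [|[|[|//]]] _; case: l' l3' => [|[|[|//]]] _ // _;
      rewrite /expo /=; lia.
  - case: k k3 kl => [|[|[|//]]] _; case: l l3 => [|[|[|//]]] _ // _;
      case: k' k3' kl' => [|[|[|//]]] _; case: l' l3' => [|[|[|//]]] _ // _;
      rewrite /expo /=; lia.
  - case: k k3 kl => [|[|[|//]]] _; case: l l3 => [|[|[|//]]] _ // _;
      case: k' k3' kl' => [|[|[|//]]] _; case: l' l3' => [|[|[|//]]] _ // _;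
      rewrite /expo /=; lia.
move: e1 e2; rewrite q10 q20 !mulr0.
case: k k3 kl => [|[|[|//]]] _; case: l l3 => [|[|[|//]]] _ // _;
  case: k' k3' kl' => [|[|[|//]]] _; case: l' l3' => [|[|[|//]]] _ // _;
  rewrite /expo /= => e1 e2; split; lia.
Qed.

(** * Orthogonality of the wave functions on the alcove *)

Section Orthogonality.
Variables (C : numFieldType) (n : nat) (eta : C).
Local Notation N := (3 * n + 3)%N.
Hypothesis eta_prim : (3 * N).-primitive_root eta.

Lemma eta_neq0 : eta != 0.
Proof. by rewrite (prim_root_eq0 eta_prim) addn3. Qed.

Lemma eta_eq1 (z : int) : (eta ^ z == 1) = ((3 * N)%:Z %| z)%Z.
Proof.
case: z => z; first by rewrite -exprnP -(prim_order_dvd eta_prim) dvdzE.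
by rewrite NegzE -exprz_inv -exprnP exprVn invr_eq1 -(prim_order_dvd eta_prim) dvdzE
  abszN.
Qed.

Definition freq (p : alcove n) (k : nat) : C := eta ^ expo (pa p) (pb p) k.
Definition freqV (p : alcove n) (k : nat) : C := eta ^ (- expo (pa p) (pb p) k).
Definition wave (p q : alcove n) : C := slater (freq p) (pa q) (pb q).
Definition waveV (p q : alcove n) : C := slater (freqV p) (pa q) (pb q).

Lemma freq_prod p : freq p 0 * freq p 1 * freq p 2 = 1.
Proof. by rewrite /freq -!expfzDr ?eta_neq0 // expo_sum. Qed.

Lemma freqV_prod p : freqV p 0 * freqV p 1 * freqV p 2 = 1.
Proof.
rewrite /freqV -!expfzDr ?eta_neq0 // -[RHS](expr0z eta); congr (_ ^ _).
by have := expo_sum (pa p) (pb p); lia.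
Qed.

(** The common [N]-th power of the three frequencies, a cube root of unity. *)
Definition freq_twist (p : alcove n) : C := eta ^ (- (N * (pa p + pb p))%:Z).

Lemma freq_N p k : freq p k ^+ N = freq_twist p.
Proof.
rewrite /freq /freq_twist exprnP exprz_exp; apply/eqP.
rewrite -subr_eq0 -(inj_eq (mulIf (expfz_neq0 (N * (pa p + pb p))%:Z eta_neq0))) mul0r.
rewrite mulrBl -!expfzDr ?eta_neq0 // addNr expr0z subr_eq0 eta_eq1.
apply/dvdzP; exists (triple (pa p) (pb p) k)%:Z; rewrite /expo !PoszM !PoszD; ring.
Qed.

Lemma freqV_N p k : freqV p k ^+ N = (freq_twist p)^-1.
Proof.
by rewrite -(freq_N p k) -exprVn /freq /freqV invr_expz.
Qed.

Lemma freq_mul p q k l : freq p k * freqV q l =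
  eta ^ (expo (pa p) (pb p) k - expo (pa q) (pb q) l).
Proof. by rewrite /freq /freqV -expfzDr ?eta_neq0. Qed.

Lemma geometric_sum p q k l : freq_twist p = freq_twist q ->
  \sum_(x < N) (freq p k * freqV q l) ^+ x =
  N%:R *+ ((3 * N)%:Z %| expo (pa p) (pb p) k - expo (pa q) (pb q) l)%Z.
Proof.
move=> e; set z := _ * _.
have zN : z ^+ N = 1.
  by rewrite exprMn freq_N freqV_N e divff // /freq_twist expfz_neq0 // eta_neq0.
rewrite -eta_eq1 -freq_mul -/z; have [z1|z1] := eqVneq z 1.
  by rewrite z1; under eq_bigr do rewrite expr1n; rewrite sumr_const card_ord.
have := subrX1 z N; rewrite zN subrr => /esym/eqP.
by rewrite mulf_eq0 subr_eq0 (negPf z1) => /eqP.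
Qed.

Let rot_lt (p : alcove n) : (0 < pb p - pa p < N - pa p)%N.
Proof. by have := alcoveP p; lia. Qed.
Let rot_ltN (p : alcove n) : (N - pa p < N)%N.
Proof. by have := alcoveP p; lia. Qed.
(** The cyclic rotation of the barycentric coordinates [(a, b - a, N - b)]. *)
Let rot (p : alcove n) : alcove n := s2val (alcove_ex (rot_lt p) (rot_ltN p)).
Let rot_a p : pa (rot p) = (pb p - pa p)%N.
Proof. by rewrite /rot; case: alcove_ex. Qed.
Let rot_b p : pb (rot p) = (N - pa p)%N.
Proof. by rewrite /rot; case: alcove_ex. Qed.

Let rot_inj : injective rot.
Proof.
move=> p q e; have := congr1 (@pa n) e; have := congr1 (@pb n) e.
rewrite !rot_a !rot_b; have := alcoveP p; have := alcoveP q => h h' e1 e2.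
by apply: alcove_inj; lia.
Qed.

(* If the twists differ, the cyclic rotation of the alcove multiplies the sum by a
   constant other than 1. Otherwise the sum extends to the torus (Z/N)^2. *)
Lemma wave_orth p q :
  \sum_r wave p r * waveV q r = (3 * N ^ 2)%:R *+ (p == q).
Proof.
have [e|ne] := eqVneq (freq_twist p) (freq_twist q); last first.
  have kq : freq_twist q != 0 by rewrite /freq_twist expfz_neq0 // eta_neq0.
  have -> : (p == q) = false by apply: contra_neqF ne => /eqP ->.
  apply/eqP; set s := \sum_r _.
  have : s = (freq_twist p / freq_twist q) * s.
    rewrite {1}/s (reindex_inj rot_inj) mulr_sumr; apply: eq_bigr => r _.
    have := alcoveP r => hr.
    rewrite /wave /waveV !rot_a !rot_b.
    rewrite (slater_rot (freq_prod p) _ _ (fun k _ => freq_N p k)); [|lia|lia].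
    rewrite (slater_rot (freqV_prod q) _ _ (fun k _ => freqV_N q k)); [|lia|lia].
    by rewrite mulrACA.
  move/eqP; rewrite -subr_eq0 -{1}[s]mul1r -mulrBl mulf_eq0 subr_eq0.
  case/orP => // /eqP h; case/negP: ne.
  by rewrite -(mulfVK kq (freq_twist p)) -h mul1r.
have -> : \sum_r wave p r * waveV q r =
  (\sum_(x < N) \sum_(y < N) slater (freq p) x y * slater (freqV q) x y) / 2%:R.
  rewrite (@sum_alcove_torus _ _ (fun x y => slater (freq p) x y * slater (freqV q) x
    y)).
  - by rewrite -[X in X / _]mulr_natr mulfK ?pnatr_eq0.
  - by move=> x y; rewrite slaterC [slater (freqV q) _ _]slaterC mulrNN.
  - by move=> x; rewrite slater_diag mul0r.
  - by move=> y; rewrite slater0 mul0r.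
rewrite slater_torus.
have E (k l k' l' : 'I_3) :
    eps3 C k l * eps3 C k' l' * ((\sum_(x < N) (freq p k * freqV q k') ^+ x) *
      (\sum_(x < N) (freq p l * freqV q l') ^+ x)) =
    if [&& p == q, k' == k & l' == l] then eps3 C k l ^+ 2 * (N ^ 2)%:R else 0.
  have [<-|kl] := eqVneq k l; first by rewrite /eps3 subrr expr0n !mul0r if_same.
  have [<-|kl'] := eqVneq k' l'.
    rewrite {2}/eps3 subrr mulr0 mul0r; case: and3P => // -[_ /eqP e1 /eqP e2].
    by rewrite -e1 -e2 eqxx in kl.
  rewrite !geometric_sum //; case: and3P => [[/eqP <- /eqP -> /eqP ->]|h].
    by rewrite !subrr !dvdz0 expr2 -mulnn natrM !mulr1n.
  case: (boolP (_ %| _)%Z) => h1; last by rewrite mulr0n mul0r mulr0.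
  case: (boolP (_ %| _)%Z) => h2; last by rewrite mulr0n !mulr0.
  have [h3 h4] := alcoveP p; have [h5 h6] := alcoveP q.
  have [||e1 e2 e3 e4] := expo_sep h3 h4 h5 h6 (ltn_ord k) (ltn_ord l)
    (ltn_ord k') (ltn_ord l') _ _ h1 h2.
  - by move/val_inj/eqP; rewrite (negPf kl).
  - by move/val_inj/eqP; rewrite (negPf kl').
  by case: h; split; apply/eqP; [apply: alcove_inj|apply: ord_inj|apply: ord_inj].
under eq_bigr do under eq_bigr do under eq_bigr do under eq_bigr do rewrite E.
case: (p == q); last first.
  by rewrite big1 ?mul0r // => k _; rewrite big1 // => l _; rewrite big1 // => k' _;
    rewrite big1.
have -> : \sum_(k < 3) \sum_(l < 3) \sum_(k' < 3) \sum_(l' < 3)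
    (if [&& true, k' == k & l' == l] then eps3 C k l ^+ 2 * (N ^ 2)%:R else 0) =
    \sum_(k < 3) \sum_(l < 3) eps3 C k l ^+ 2 * (N ^ 2)%:R.
  apply: eq_bigr => k _; apply: eq_bigr => l _ /=.
  rewrite (bigD1 k) //= (bigD1 l) //= !eqxx /= !big1 ?addr0 //.
    by move=> k' /negPf ->; rewrite big1.
  by move=> l' /negPf ->.
(* [eps3] is 1 or -1 at six pairs, and half of [6 N ^ 2] is [3 N ^ 2]. *)
rewrite !big_ord_recl !big_ord0 /= /eps3 /bump /=.
apply: (mulIf (_ : 2%:R != 0 :> C)); first by rewrite pnatr_eq0.
rewrite divfK ?pnatr_eq0 // natrM; ring.
Qed.
End Orthogonality.

(** * The edges and the squared determinant *)

(* An edge encodes the lattice point (x, y) with ea = x + 2y - 2n + 2 and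
   eb = 2n + 2 - x + y, or a horizontal unit segment of the region, between the
   downward triangle (ea + 1, eb) and the upward triangle (ea, eb) of the alcove.
   The first is missing if [ebot] and the second if [etop]. *)
Definition edge (n : nat) :=
  {e : 'I_(3 * n + 3) * 'I_(3 * n + 3) |
    [&& (e.1 < e.2)%N, (1 < e.2)%N & ((e.1 + e.2) %% 3 == 1)%N]}.
Definition ea n (e : edge n) : nat := (val e).1.
Definition eb n (e : edge n) : nat := (val e).2.

Lemma edge_inj n (e f : edge n) : ea e = ea f -> eb e = eb f -> e = f.
Proof.
case: e f => [[a b] h] [[a' b'] h']; rewrite /ea /eb /= => e e'.
by apply: val_inj; congr pair; apply: val_inj.
Qed.

Lemma edgeP n (e : edge n) :
  [/\ (ea e < eb e)%N, (1 < eb e)%N, (eb e < 3 * n + 3)%N & ((ea e + eb e) %% 3 = 1)%N].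
Proof. by case/and3P: (valP e) => h1 h2 /eqP h3; split=> //; apply: ltn_ord. Qed.

Lemma edge_ex n (a b : nat) : (a < b)%N -> (1 < b)%N -> (b < 3 * n + 3)%N ->
  ((a + b) %% 3 = 1)%N -> {e : edge n | ea e = a & eb e = b}.
Proof.
move=> ab b1 bN m; have aN := ltn_trans ab bN.
have h : [&& ((Ordinal aN, Ordinal bN).1 < (Ordinal aN, Ordinal bN).2)%N,
  (1 < (Ordinal aN, Ordinal bN).2)%N &
  (((Ordinal aN, Ordinal bN).1 + (Ordinal aN, Ordinal bN).2) %% 3 == 1)%N].
  by rewrite /= ab b1 m.
by exists (Sub (Ordinal aN, Ordinal bN) h).
Qed.

Definition etop n (e : edge n) := ea e == 0%N.
Definition ebot n (e : edge n) := eb e == (ea e).+1.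
Definition estep n (e f : edge n) :=
  ((ea f == (ea e).+1) && ((eb f).+1 == eb e)) ||
  ((ea f == (ea e).+2) && (eb f == (eb e).+1)).
(* A matching of downward with upward triangles is a permutation of the edges, once
   each final edge is sent to the initial edge with the same [eb]: then a family
   of paths is a permutation with one cycle per path and fixed points elsewhere. *)
Definition elink n (e f : edge n) :=
  if ebot e then etop f && (eb f == eb e) else ~~ etop f && ((f == e) || estep e f).

Lemma sum_pair_N (m : nat) (f : nat -> nat -> nat) :
  (\sum_(p : 'I_m * 'I_m) f p.1 p.2 = \sum_(0 <= b < m) \sum_(0 <= a < m) f a b)%N.
Proof.
rewrite -(pair_bigA _ (fun i j : 'I_m => f i j)) /= exchange_big /= big_mkord.
by apply: eq_bigr => b _; rewrite big_mkord.
Qed.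

Lemma card_pairs (m : nat) (P : pred ('I_m * 'I_m)) (f : nat -> nat -> bool) :
  (forall p, P p = f p.1 p.2) ->
  #|{: {p | P p}}| = (\sum_(0 <= b < m) \sum_(0 <= a < m) f a b)%N.
Proof.
move=> Pf; rewrite card_sig -sum1_card big_mkcond /= -(sum_pair_N m (fun a b =>
  nat_of_bool (f a b))).
by apply: eq_bigr => p _; rewrite unfold_in Pf; case: (f _ _).
Qed.

Lemma sum_bool_lt (m b : nat) (g : nat -> bool) : (b <= m)%N ->
  (\sum_(0 <= a < m) ((a < b) && g a) = \sum_(0 <= a < b) g a)%N.
Proof.
move=> bm; rewrite (big_cat_nat _ bm) //=.
rewrite -[RHS]addn0; congr (_ + _)%N.
  by apply: eq_big_nat => a /andP[_ ->].
rewrite big_nat_cond big1 // => a /andP[/andP[h _] _].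
by rewrite ltnNge h.
Qed.

Lemma sum_mod3 (b r : nat) : (r < 3)%N ->
  (\sum_(0 <= a < b) (a %% 3 == r) = (b + 2 - r) %/ 3)%N.
Proof.
move=> r3; elim: b => [|b IH]; first by rewrite big_nil; lia.
by rewrite big_nat_recr //= IH; lia.
Qed.

Lemma card_alcove n : (2 * #|{: alcove n}| = (3 * n + 2) * (3 * n + 1))%N.
Proof.
rewrite (@card_pairs _ _ (fun a b => 0 < a < b)%N) //.
have E b : (0 <= b < 3 * n + 3)%N ->
    (\sum_(0 <= a < 3 * n + 3) ((0 < a) && (a < b)) = b.-1)%N.
  move=> /andP[_ bN].
  under eq_bigr do rewrite andbC.
  rewrite (sum_bool_lt (fun a => 0 < a)%N (ltnW bN)).
  elim: b {bN} => [|b IH]; first by rewrite big_nil.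
  by rewrite big_nat_recr //= IH; lia.
rewrite (eq_big_nat _ _ E) {E}; elim: n => [|n IH]; first by rewrite !muln0 unlock.
rewrite mulnS (_ : (3 + 3 * n + 3 = (3 * n + 3).+3)%N); last by lia.
rewrite !big_nat_recr //=; lia.
Qed.

(** Used for the exponent count in [det_spectral]. The condition [1 < b] discards the pair (0, 1),
    which would be an initial and a final edge at once. *)
Lemma card_edge n : (2 * #|{: edge n}| = 3 * n * (n + 1) + 2 * n)%N.
Proof.
rewrite (@card_pairs _ _ (fun a b => [&& a < b, 1 < b & (a + b) %% 3 == 1])%N) //.
have E b : (0 <= b < 3 * n + 3)%N ->
    (\sum_(0 <= a < 3 * n + 3) [&& a < b, 1 < b & (a + b) %% 3 == 1] =
     if 1 < b then (b + 2 - (2 * b + 1) %% 3) %/ 3 else 0)%N.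
  move=> /andP[_ bN].
  rewrite (sum_bool_lt (fun a => (1 < b) && ((a + b) %% 3 == 1))%N (ltnW bN)).
  case: ifP => b1; last by rewrite big1.
  rewrite -sum_mod3 ?ltn_mod //; apply: eq_bigr => a _.
  by congr nat_of_bool; apply/eqP/eqP => /=; lia.
rewrite (eq_big_nat _ _ E) {E}; elim: n => [|n IH]; first by rewrite !muln0 unlock.
rewrite mulnS (_ : (3 + 3 * n + 3 = (3 * n + 3).+3)%N); last by lia.
rewrite !big_nat_recr //= !ifT; lia.
Qed.

Lemma card_ebot n : #|[pred e : edge n | ebot e]| = n.
Proof.
have h (i : 'I_n) : {e : edge n | ea e = (3 * i + 3)%N & eb e = (3 * i + 4)%N}.
  by apply: edge_ex; have := ltn_ord i; lia.
pose f i := s2val (h i).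
have fa i : ea (f i) = (3 * i + 3)%N by rewrite /f; case: (h i).
have fb i : eb (f i) = (3 * i + 4)%N by rewrite /f; case: (h i).
rewrite -[RHS]card_ord -(fintype.card_codom (f := f)); last first.
  by move=> i j e; apply: ord_inj; have := congr1 (@ea n) e; rewrite !fa; lia.
apply: eq_card => e; rewrite inE; apply/eqP/codomP => [e1|[i ->]]; last by rewrite fa
  fb; lia.
have := edgeP e; rewrite e1 => -[h1 h2 h3 h4].
have hi' : ((ea e) %/ 3 - 1 < n)%N by lia.
by exists (Ordinal hi'); apply: edge_inj; rewrite ?fa ?fb ?e1 /=; lia.
Qed.

Lemma mulmx_mxf_diag (R : pzSemiRingType) (I J : finType) (f : I -> J -> R) (d : J ->
  R) :
  mxf f *m mxf (fun i j => d i *+ (i == j)) = mxf (fun i j => f i j * d j).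
Proof.
rewrite mulmx_mxf; apply: eq_mxf => i j.
rewrite (bigD1 j) //= eqxx mulr1n big1 ?addr0 // => k /negPf ->.
by rewrite mulr0n mulr0.
Qed.

Lemma mulmx_diag_mxf (R : pzSemiRingType) (I J : finType) (f : I -> J -> R) (d : I ->
  R) :
  mxf (fun i j => d i *+ (i == j)) *m mxf f = mxf (fun i j => d i * f i j).
Proof.
rewrite mulmx_mxf; apply: eq_mxf => i j.
rewrite (bigD1 i) //= eqxx mulr1n big1 ?addr0 // => k.
by rewrite eq_sym => /negPf ->; rewrite mulr0n mul0r.
Qed.

Section Points.
Variable n : nat.
Lemma center_ex : {p : alcove n | pa p = n.+1 & pb p = (2 * n + 2)%N}.
Proof. by apply: alcove_ex; lia. Qed.
(** The barycentre of the alcove: its frequencies are the three cube roots of unity, so its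
    eigenvalue is 0. *)
Definition center := s2val center_ex.

Definition edown (e : edge n) (p : alcove n) := (pa p == (ea e).+1) && (pb p == eb e).
Definition eup (e : edge n) (p : alcove n) := (pa p == ea e) && (pb p == eb e).

Lemma edown_ex (e : edge n) : ~~ ebot e -> {p : alcove n | pa p = (ea e).+1 & pb p =
  eb e}.
Proof. by rewrite /ebot; have := edgeP e => -[? ? ? ?] ?; apply: alcove_ex; lia. Qed.
Lemma eup_ex (e : edge n) : ~~ etop e -> {p : alcove n | pa p = ea e & pb p = eb e}.
Proof. by rewrite /etop; have := edgeP e => -[? ? ? ?] ?; apply: alcove_ex; lia. Qed.

Lemma sum_edown (R : pzSemiRingType) (f : alcove n -> R) (e : edge n) p :
  pa p = (ea e).+1 -> pb p = eb e -> \sum_r (edown e r)%:R * f r = f p.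
Proof.
move=> pa_ pb_; rewrite (bigD1 p) //= /edown pa_ pb_ !eqxx mul1r big1 ?addr0 // => r rp.
case: andP => [[/eqP h1 /eqP h2]|_]; last by rewrite mul0r.
by case/eqP: rp; apply: alcove_inj; rewrite ?pa_ ?pb_.
Qed.

Lemma sum_edown0 (R : pzSemiRingType) (f : alcove n -> R) (e : edge n) : ebot e ->
  \sum_r (edown e r)%:R * f r = 0.
Proof.
rewrite /ebot => be; rewrite big1 // => r _; rewrite /edown.
case: andP => [[/eqP h1 /eqP h2]|_]; last by rewrite mul0r.
by have := alcoveP r; lia.
Qed.

Lemma sum_eup (R : pzSemiRingType) (f : alcove n -> R) (e : edge n) p :
  pa p = ea e -> pb p = eb e -> \sum_r f r * (eup e r)%:R = f p.
Proof.
move=> pa_ pb_; rewrite (bigD1 p) //= /eup pa_ pb_ !eqxx mulr1 big1 ?addr0 // => r rp.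
case: andP => [[/eqP h1 /eqP h2]|_]; last by rewrite mulr0.
by case/eqP: rp; apply: alcove_inj; rewrite ?pa_ ?pb_.
Qed.

Lemma sum_eup0 (R : pzSemiRingType) (f : alcove n -> R) (e : edge n) : etop e ->
  \sum_r f r * (eup e r)%:R = 0.
Proof.
rewrite /etop => be; rewrite big1 // => r _; rewrite /eup.
case: andP => [[/eqP h1 /eqP h2]|_]; last by rewrite mulr0.
by have := alcoveP r; lia.
Qed.

End Points.

(** * Spectrum of the move operator and its blocks between colours *)

Section Apply.
Variables (C : numFieldType) (n : nat) (eta : C).
Local Notation N := (3 * n + 3)%N.
Hypothesis eta_prim : (3 * N).-primitive_root eta.

Definition eig (p : alcove n) : C := freq eta p 0 + freq eta p 1 + freq eta p 2.
Definition eigV (p : alcove n) : C :=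
  freq eta p 1 * freq eta p 2 + freq eta p 0 * freq eta p 2 + freq eta p 0 * freq eta
    p 1.

Let W : alcove n -> alcove n -> C := wave eta.

(** The walls [x = 0], [x = y] and [y = N] are outside the alcove, but the determinant vanishes
    there, so the eigenvector identities need no boundary correction. *)
Lemma sum_slater_delta p x y : (x <= y <= N)%N ->
  \sum_(r : alcove n) ((pa r == x) && (pb r == y))%:R * W p r =
  slater (freq eta p) x y.
Proof.
move=> /andP[xy yN]; rewrite (sum_alcove_delta n (slater (freq eta p))).
case: ifP => // /negbT; rewrite negb_and negb_and -!leqNgt => h.
have [x0|x0] := posnP x; first by rewrite x0 slater0.
have [<-|nxy] := eqVneq x y; first by rewrite slater_diag.
have -> : y = N by lia.
by rewrite (slater_end _ (fun k _ => freq_N eta_prim p k)).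
Qed.

Lemma wave_down p q : \sum_r (pmove q r)%:R * W p r = eigV p * W p q.
Proof.
have /= hq := alcoveP q; rewrite /W /wave /eigV.
have [x ex] : exists x, pa q = x.+1 by exists (pa q).-1; lia.
have [y ey] : exists y, pb q = y.+1 by exists (pb q).-1; lia.
rewrite ex ey -slater_down ?freq_prod //.
rewrite -(@sum_slater_delta p x y.+1) -?(@sum_slater_delta p x.+1 y)
  -?(@sum_slater_delta p x.+2 y.+2); try lia.
rewrite -!big_split /=; apply: eq_bigr => r _; rewrite -!mulrDl -!natrD; congr (_%:R
  * _).
by rewrite /pmove ex ey !eqSS; lia.
Qed.

Lemma wave_up p q : \sum_r (pmove r q)%:R * W p r = eig p * W p q.
Proof.
have /= hq := alcoveP q; rewrite /W /wave /eig.
have [x ex] : exists x, pa q = x.+1 by exists (pa q).-1; lia.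
have [y ey] : exists y, pb q = y.+1 by exists (pb q).-1; lia.
rewrite ex ey -slater_up ?freq_prod //.
rewrite -(@sum_slater_delta p x y) -?(@sum_slater_delta p x.+1 y.+2)
  -?(@sum_slater_delta p x.+2 y.+1); try lia.
rewrite -!big_split /=; apply: eq_bigr => r _; rewrite -!mulrDl -!natrD; congr (_%:R
  * _).
by rewrite /pmove ex ey !eqSS ![_ == pa r]eq_sym ![_ == pb r]eq_sym; lia.
Qed.

Definition color (c : nat) (p : alcove n) : C := ((pa p + pb p) %% 3 == c)%N%:R.
Let Pm c : 'M[C]_#|{: alcove n}| := mxf (fun p q => color c p *+ (p == q)).

Lemma color_color c d p : color c p * color d p = color c p *+ (c == d).
Proof.
rewrite /color -natrM mulnb; case: (eqVneq c d) => [->|cd]; first by rewrite andbb.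
by case: eqP => [->|//]; rewrite (negPf cd).
Qed.

Let Pm_mul c d : Pm c *m Pm d = if c == d then Pm c else 0.
Proof.
rewrite mulmx_diag_mxf; have [<-|cd] := eqVneq c d.
  by apply: eq_mxf => p q; rewrite mulrnAr color_color eqxx mulr1n.
apply/matrixP => i j; rewrite !mxE mulrnAr color_color (negPf cd) mulr0n mul0rn //.
Qed.

Let Pm_tr c : (Pm c)^T = Pm c.
Proof.
rewrite mxf_tr; apply: eq_mxf => p q; rewrite eq_sym.
by case: eqP => [->|_]; rewrite ?mulr0n.
Qed.

Let M : 'M[C]_#|{: alcove n}| := mxf (fun p q => (pmove p q)%:R).

(** A move changes [pa + pb] by -1 or by 2, that is, by -1 mod 3. *)
Let M_color c : (c < 3)%N -> M *m Pm c = Pm (c.+1 %% 3)%N *m M.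
Proof.
move=> c3; rewrite mulmx_mxf_diag mulmx_diag_mxf; apply: eq_mxf => p q.
rewrite mulrC /color -!natrM !mulnb; congr (nat_of_bool _)%:R.
have hp := alcoveP p; have hq := alcoveP q.
case: (boolP (pmove p q)); rewrite ?andbF ?andbT // /pmove => h.
by apply/eqP/eqP; lia.
Qed.

Lemma eig_center : eigV (center n) * eig (center n) = 0.
Proof.
have ha : pa (center n) = n.+1 by rewrite /center; case: center_ex.
have hb : pb (center n) = (2 * n + 2)%N by rewrite /center; case: center_ex.
suff -> : eig (center n) = 0 by rewrite mulr0.
pose w := eta ^+ N.
have w0 := eta_neq0 eta_prim.
have w3 : w ^+ 3 = 1 by rewrite -exprM mulnC (prim_expr_order eta_prim).
have w1 : w != 1.
  rewrite /w -(prim_order_dvd eta_prim); apply/negP => /dvdn_leq; lia.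
have e : 1 + w + w ^+ 2 = 0.
  apply/eqP; have := subrX1 w 3; rewrite w3 subrr => /esym/eqP.
  rewrite mulf_eq0 subr_eq0 (negPf w1) /= !big_ord_recr big_ord0 /= add0r expr0 expr1.
  by [].
rewrite /eig /freq /expo ha hb /=.
have -> : 3 * 0 - (n.+1 + (2 * n + 2))%N%:Z = - N%:Z by lia.
have -> : 3 * n.+1%:Z - (n.+1 + (2 * n + 2))%N%:Z = 0 by lia.
have -> : 3 * (2 * n + 2)%N%:Z - (n.+1 + (2 * n + 2))%N%:Z = N%:Z by lia.
rewrite -exprz_inv -!exprnP exprVn -/w expr0.
have w00 : w != 0 by rewrite expf_neq0.
apply: (mulfI w00); rewrite mulr0 !mulrDr divff // mulr1 -expr2 //.
Qed.

Let I1 : 'M[C]_(#|{: edge n}|, #|{: alcove n}|) := mxf (fun e p => (edown e p)%:R).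
Let I2 : 'M[C]_(#|{: edge n}|, #|{: alcove n}|) := mxf (fun e p => (eup e p)%:R).
Let G : 'M[C]_#|{: edge n}| := mxf (fun e f => [&& ebot e, etop f & eb f == eb e]%:R).

Lemma elink_decomp : I1 *m M *m I2^T + G = mxf (fun e f => (elink e f)%:R).
Proof.
rewrite mxf_tr !mulmx_mxf mxfD; apply: eq_mxf => e f.
have he := edgeP e; have hf := edgeP f.
case: (boolP (etop f)) => tf.
  rewrite sum_eup0 // add0r /elink tf /=; by case: ifP.
have [q qa qb] := eup_ex tf; rewrite (sum_eup _ qa qb) andbF addr0.
case: (boolP (ebot e)) => be.
  by rewrite sum_edown0 // /elink be (negPf tf).
have [p pa_ pb_] := edown_ex be; rewrite (sum_edown _ pa_ pb_).
congr (nat_of_bool _)%:R; rewrite /elink (negPf be) tf /=.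
have -> : (f == e) = (ea f == ea e) && (eb f == eb e).
  by apply/eqP/andP => [->|[/eqP h1 /eqP h2]] //; apply: edge_inj.
by rewrite /pmove /estep pa_ pb_ qa qb; lia.
Qed.

Lemma det_elink : \det (mxf (fun e f : edge n => (elink e f)%:R) : 'M[C]_#|{: edge
  n}|) ^+ 6 =
  \prod_(p : alcove n | p != center n) (eigV p * eig p).
Proof.
rewrite -elink_decomp [RHS](reindex _ (onW_bij _ (enum_val_bij (alcove n)))) /=.
pose F : 'M[C]_#|{: alcove n}| := mxf (fun q p => W p q).
pose F' : 'M[C]_#|{: alcove n}| := mxf (fun p q => waveV eta p q).
rewrite (eq_bigl (fun i => i != enum_rank (center n))); last first.
  by move=> i; rewrite -(inj_eq enum_rank_inj) enum_valK.
(* Colour 2 consists of the downward triangles and colour 1 of the upward ones. *)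
apply: (@det_spectral _ _ _ M F (Pm 2) (Pm 1) (Pm 0) _ _ _ I1 I2 G
  (fun i => ebot (enum_val i))).
- have : F' *m F = (3 * N ^ 2)%:R%:M.
    rewrite mulmx_mxf -mxf_scalar; apply: eq_mxf => p q.
    rewrite eq_sym -(wave_orth eta_prim); apply: eq_bigr => r _.
    by rewrite mulrC.
  move=> e; suff : (((3 * N ^ 2)%:R)^-1 *: F') *m F = 1%:M by case/mulmx1_unit.
  by rewrite -scalemxAl e scale_scalar_mx mulVf // pnatr_eq0 muln_eq0 expn_eq0 addn3.
- rewrite -[diag_mx _](mxf_diag eigV) mulmx_mxf mulmx_mxf_diag.
  by apply: eq_mxf => q p; rewrite wave_down mulrC.
- rewrite -[diag_mx _](mxf_diag eig) mxf_tr mulmx_mxf mulmx_mxf_diag.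
  by apply: eq_mxf => q p; rewrite wave_up mulrC.
- exact: Pm_tr.
- exact: Pm_tr.
- exact: Pm_tr.
- by rewrite Pm_mul.
- by rewrite Pm_mul.
- by rewrite Pm_mul.
- by rewrite Pm_mul.
- by rewrite Pm_mul.
- rewrite !mxfD -mxf_scalar; apply: eq_mxf => p q; rewrite -!mulrnDl /color -!natrD.
  by congr (_ *+ _); rewrite -[RHS]/(1%:R); congr (_%:R); lia.
- by rewrite M_color.
- by rewrite M_color.
- rewrite -[diag_mx _](mxf_diag (fun e : edge n => (ebot e)%:R)) mxf_tr mulmx_mxf.
  rewrite -mxf_scalar; apply/matrixP => i j; rewrite !mxE -mulrnBl.
  move: (enum_val i) (enum_val j) => e f {i j}.
  case: (boolP (ebot e)) => be; first by rewrite sum_edown0 // subrr mul0rn.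
  have [p pa_ pb_] := edown_ex be; rewrite (sum_edown _ pa_ pb_) subr0.
  congr (_%:R); rewrite /edown pa_ pb_ eqSS; congr nat_of_bool.
- rewrite mxf_tr mulmx_mxf; apply: eq_mxf => p q.
  have hp := alcoveP p.
  case: (boolP ((pa p + pb p) %% 3 == 2)%N) => c2; last first.
    rewrite /color (negPf c2) mul0rn big1 // => e _; have he := edgeP e.
    rewrite /edown; case: andP => [[/eqP h1 /eqP h2]|_]; last by rewrite mul0r.
    by move: c2; rewrite h1 h2; case: he => _ _ _; lia.
  have [e he1 he2] : {e : edge n | ea e = (pa p).-1 & eb e = pb p}.
    by apply: edge_ex; lia.
  rewrite (bigD1 e) //= big1 ?addr0 => [|f fe].
    rewrite /color c2 /edown he1 he2 -natrM mulnb prednK; last by lia.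
    rewrite !eqxx /=; congr (_%:R); congr nat_of_bool.
    by apply/andP/eqP => [[/eqP h1 /eqP h2]|<- //]; apply: alcove_inj.
  rewrite /edown; case: andP => [[/eqP h1 /eqP h2]|_]; last by rewrite mul0r.
  by case/eqP: fe; apply: edge_inj; rewrite ?he1 ?he2 //; lia.
- rewrite -[diag_mx _](mxf_diag (fun e : edge n => (ebot e)%:R)) mulmx_diag_mxf.
  apply/matrixP => i j; rewrite !mxE; case: (boolP (ebot _)) => be; last by rewrite
    mul0r.
  rewrite mul1r; have := sum_edown0 (fun r => (r == enum_val j)%:R : C) be.
  by rewrite (bigD1 (enum_val j)) //= eqxx mulr1 big1 ?addr0 // => r /negPf ->;
    rewrite mulr0.
- rewrite mxf_tr mulmx_mxf; apply: eq_mxf => p q.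
  have hp := alcoveP p.
  case: (boolP ((pa p + pb p) %% 3 == 1)%N) => c2; last first.
    rewrite /color (negPf c2) mul0rn big1 // => e _; have he := edgeP e.
    rewrite /eup; case: andP => [[/eqP h1 /eqP h2]|_]; last by rewrite mul0r.
    by move: c2; rewrite h1 h2; case: he => _ _ _; lia.
  have [e he1 he2] : {e : edge n | ea e = pa p & eb e = pb p}.
    by apply: edge_ex; lia.
  rewrite (bigD1 e) //= big1 ?addr0 => [|f fe].
    rewrite /color c2 /eup he1 he2 -natrM mulnb.
    rewrite !eqxx /=; congr (_%:R); congr nat_of_bool.
    by apply/andP/eqP => [[/eqP h1 /eqP h2]|<- //]; apply: alcove_inj.
  rewrite /eup; case: andP => [[/eqP h1 /eqP h2]|_]; last by rewrite mul0r.
  by case/eqP: fe; apply: edge_inj; rewrite ?he1 ?he2 //; lia.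
- rewrite mulmx_mxf; apply/matrixP => i j; rewrite !mxE big1 // => e _.
  case: and3P => [[h1 h2 h3]|_]; last by rewrite mul0r.
  have := sum_eup0 (fun r => (r == enum_val j)%:R : C) h2.
  rewrite (bigD1 (enum_val j)) //= eqxx mul1r big1 ?addr0 ?mul1r // => r /negPf ->.
  by rewrite mul0r.
- rewrite -[diag_mx _](mxf_diag (fun e : edge n => (ebot e)%:R)) mxf_tr mulmx_mxf.
  apply: eq_mxf => e f; have [he1 he2 he3 he4] := edgeP e; have [hf1 hf2 hf3 hf4] :=
    edgeP f.
  case: (boolP (ebot e)) => be; last by rewrite mul0rn big1 // => r _; rewrite mul0r.
  have [t t1 t2] : {t : edge n | ea t = 0%N & eb t = eb e}.
    by move: be; rewrite /ebot => /eqP be; apply: edge_ex; lia.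
  rewrite (bigD1 t) //= big1 ?addr0 => [|r rt].
    rewrite /etop t1 t2 !eqxx -natrM mulnb /=; congr (_%:R); congr nat_of_bool.
    apply/andP/eqP => [[h1 /eqP h2]|<-]; last by [].
    by move: be h1; rewrite /ebot => /eqP h3 /eqP h4; apply: edge_inj; lia.
  case: (boolP (etop r && (eb r == eb e))) => [/andP[h1 h2]|_]; last by rewrite mul0r.
  by case/eqP: rt; apply: edge_inj; rewrite ?t1 ?t2; [apply/eqP: h1|apply/eqP: h2].
- have -> : #|(fun i : 'I_#|{: edge n}| => ebot (enum_val i))| = n.
    rewrite -[RHS](card_ebot n) -(fintype.card_image (@enum_val_inj _ (predT : pred
      (edge n)))).
    apply: eq_card => e; rewrite [RHS]inE; apply/fintype.imageP/idP => [[i h ->] //|h].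
    by exists (enum_rank e); rewrite ?enum_rankK // unfold_in enum_rankK.
  have := card_alcove n; have := card_edge n; lia.
- by rewrite enum_rankK eig_center.
Qed.
End Apply.

(** * The product formula *)

Section Root.
Local Open Scope complex_scope.
Variable R : realType.

Definition cis (x : R) : R[i] := cos x +i* sin x.

Lemma cisX x k : cis x ^+ k = cis (x *+ k).
Proof.
elim: k => [|k IH]; first by rewrite expr0 mulr0n /cis cos0 sin0.
rewrite exprS IH mulrS /cis cosD sinD; apply/eqP; rewrite eq_complex /=.
by rewrite eqxx /= addrC [cos x * _]mulrC [sin x * _]mulrC.
Qed.

Lemma cis_eq1 x : 0 < x < pi *+ 2 -> cis x != 1.
Proof.
move=> /andP[x0 x2]; apply/eqP => e.
have s0 : 0 < sin (x / 2) by apply: sin_gt0_pi; rewrite -mulr_natr in x2; lra.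
have c : cos x = 1 by have := congr1 (@complex.Re R) e.
have : cos (x / 2 + x / 2) = 1 by rewrite -splitr.
rewrite cosD; have := cos2Dsin2 (x / 2); nra.
Qed.

Lemma cis_prim m : (0 < m)%N -> m.-primitive_root (cis (pi *+ 2 / m%:R)).
Proof.
move=> m0; apply/andP; split=> //; apply/forallP => i; rewrite unity_rootE.
have mR : 0 < m%:R :> R by rewrite ltr0n.
have p0 : 0 < pi *+ 2 :> R by rewrite pmulrn_lgt0 // pi_gt0.
rewrite cisX; have := ltn_ord i; rewrite leq_eqVlt => /predU1P[->|im].
  rewrite -[X in cis X]mulr_natr mulfVK ?(gt_eqF mR) // eqxx eqb_id.
  by rewrite /cis -[pi *+ 2]add0r cosD2pi sinD2pi cos0 sin0.
have /negPf -> : cis (pi *+ 2 / m%:R *+ i.+1) != 1 :> R[i].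
  apply: cis_eq1; rewrite -[X in 0 < X < _]mulr_natr -mulrA [_^-1 * _]mulrC.
  by rewrite mulr_gt0 ?divr_gt0 ?ltr0n //= gtr_pMr // ltr_pdivrMr // mul1r ltr_nat.
by rewrite (ltn_eqF im).
Qed.

Lemma zeta_cis n : zeta R n = cis (pi *+ 2 / (3 * (3 * n + 3))%:R) ^+ 3.
Proof.
rewrite cisX /zeta /cis; set x := _ / _; set y := _ *+ 3.
suff -> : x = y by [].
have : (3 * n + 3)%:R != 0 :> R by rewrite pnatr_eq0 addn3.
rewrite /x /y -mulr_natl -[pi *+ 2]mulr_natl natrM; move: ((3 * n + 3)%:R) => N N0.
  by field; move: N0; rewrite mulr1.
Qed.
End Root.

Section Final.
Local Open Scope complex_scope.
Variables (R : realType) (n : nat).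
Local Notation N := (3 * n + 3)%N.
Let eta : R[i] := cis (pi *+ 2 / (3 * N)%:R).

Lemma eta_prim : (3 * N).-primitive_root eta.
Proof. by apply: cis_prim; rewrite muln_gt0 addn3. Qed.

Let eta0 : eta != 0.
Proof. by rewrite (prim_root_eq0 eta_prim) addn3. Qed.

Let norm_eta_z (z : int) : `|eta ^ z| = 1.
Proof.
have e1 : `|eta| = 1.
  have N0 : (0 < 3 * N)%N by rewrite muln_gt0 addn3.
  apply/eqP; rewrite -(@pexpr_eq1 _ _ (3 * N)%N) ?normr_ge0 //.
  by rewrite -normrX (prim_expr_order eta_prim) normr1.
by case: z => z; rewrite ?NegzE -?exprz_inv -exprnP normrX ?normrV ?e1 ?invr1 ?expr1n
  // unitfE.
Qed.

(** The normalising shift in [expo] is a factor of modulus 1, and [zeta] is [eta ^+ 3]. *)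
Lemma norm_eig (p : alcove n) :
  `|eig eta p| = (modulus (1 + zeta R n ^+ pa p + zeta R n ^+ pb p))%:C.
Proof.
have -> : eig eta p = eta ^ (- (pa p + pb p)%:Z) * (1 + zeta R n ^+ pa p + zeta R n
  ^+ pb p).
  rewrite /eig /freq zeta_cis -/eta -!exprM 2!exprnP !mulrDr mulr1.
  rewrite -!expfzDr //.
  by rewrite /expo /=; congr (_ ^ _ + _ ^ _ + _ ^ _); lia.
by rewrite normrM norm_eta_z mul1r.
Qed.

(** The frequencies have modulus 1 and product 1, so [eigV] is the complex conjugate of [eig]. *)
Lemma norm_eigV (p : alcove n) : `|eigV eta p| = `|eig eta p|.
Proof.
have V k : freq eta p k != 0 by rewrite expfz_neq0.
have J k : Num.conj (freq eta p k) = (freq eta p k)^-1.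
  by rewrite invC_norm norm_eta_z expr1n invr1 mul1r.
rewrite -(norm_conjC (eig eta p)) /eig /eigV !rmorphD /= !J.
have e := freq_prod eta_prim p.
congr `|_ + _ + _|; [apply: (mulfI (V 0%N))|apply: (mulfI (V 1%N))|apply: (mulfI (V
  2%N))];
  by rewrite divff ?V // -e; ring.
Qed.

Lemma prod_alcove_range (F : nat -> nat -> R) :
  \prod_(p : alcove n | p != center n) F (pa p) (pb p) =
  \prod_(1 <= a < 3 * n + 3) \prod_(1 <= b < 3 * n + 3 |
     (a < b)%N && ((a, b) != (n + 1, 2 * n + 2)%N)) F a b.
Proof.
pose G a b := if (a, b) != (n + 1, 2 * n + 2)%N then F a b else 1.
rewrite big_mkcond /= (eq_bigr (fun p : alcove n => G (pa p) (pb p))); last first.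
  move=> p _; rewrite /G; congr (if ~~ _ then _ else _).
  have ha : pa (center n) = n.+1 by rewrite /center; case: center_ex.
  have hb : pb (center n) = (2 * n + 2)%N by rewrite /center; case: center_ex.
  apply/eqP/eqP => [->|[h1 h2]]; first by rewrite ha hb addn1.
  by apply: alcove_inj; rewrite ?ha ?hb ?h1 ?h2 ?addn1.
rewrite -(big_sig _ (fun p : 'I_N * 'I_N => 0 < p.1 < p.2)%N (fun p => G p.1 p.2)).
rewrite -(pair_big_dep predT (fun a b : 'I_N => 0 < a < b)%N (fun a b : 'I_N => G a
  b)) /=.
rewrite big_geq_mkord [RHS]big_mkcond /=; apply: eq_bigr => a _.
rewrite big_geq_mkord; case: posnP => [->|a0]; first by rewrite big_pred0.
rewrite [LHS]big_mkcond [RHS]big_mkcond; apply: eq_bigr => b _ /=.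
rewrite /G; case: ltnP => ab //=; case: eqP => //= _.
by rewrite (ltn_trans a0 ab).
Qed.

Lemma prod_powR (I : Type) (s : seq I) (P : pred I) (f : I -> R) x :
  (forall i, P i -> 0 <= f i) ->
  (\prod_(i <- s | P i) f i) `^ x = \prod_(i <- s | P i) (f i `^ x).
Proof.
move=> f0; elim: s => [|i s IH]; first by rewrite !big_nil powR1.
rewrite !big_cons; case: ifP => Pi //; rewrite powRM ?IH ?f0 //.
exact: prodr_ge0.
Qed.

Lemma modulus_ge0 (z : R[i]) : 0 <= modulus z.
Proof. by rewrite /modulus; case: z => a b; apply: sqrtr_ge0. Qed.

(** Norms in [det_elink] give [T ^ 6 = Q ^ 2]; both numbers are nonnegative, so [T ^ 3 = Q] and a
    real cube root can be taken. *)
Lemma count_formula (T : nat) :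
  \det (mxf (fun e f : edge n => (elink e f)%:R) : 'M[R[i]]_#|{: edge n}|) = T%:R ->
  T%:R = \prod_(1 <= a < 3 * n + 3)
         \prod_(1 <= b < 3 * n + 3 |
                (a < b)%N && ((a, b) != (n + 1, 2 * n + 2)%N))
           modulus (1 + zeta R n ^+ a + zeta R n ^+ b) `^ (3%:R^-1) :> R.
Proof.
move=> dT; pose m a b := modulus (1 + zeta R n ^+ a + zeta R n ^+ b).
rewrite -(prod_alcove_range (fun a b => m a b `^ (3%:R^-1))).
rewrite -prod_powR => [|p _]; last exact: modulus_ge0.
set Q := \prod_(p | _) _.
have Q0 : 0 <= Q by apply: prodr_ge0 => p _; apply: modulus_ge0.
have e6 : T%:R ^+ 6 = Q ^+ 2 :> R.
  apply: complexI; rewrite !rmorphXn /= rmorph_nat.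
  have := congr1 Num.norm (det_elink eta_prim).
  rewrite dT normrX normr_nat => ->.
  rewrite normr_prod /Q rmorph_prod expr2 -big_split /=; apply: eq_bigr => p _.
  by rewrite normrM norm_eigV norm_eig.
have e3 : T%:R ^+ 3 = Q.
  by apply/eqP; rewrite -(@eqrXn2 _ 2) ?exprn_ge0 ?ler0n // -exprM e6.
rewrite -e3 -powR_mulrn ?ler0n // -powRrM mulfV ?powRr1 ?ler0n //.
Qed.
End Final.

(** * Planarity *)

Lemma iter_mul_fix (T : Type) (f : T -> T) p x m :
  iter p f x = x -> iter (m * p) f x = x.
Proof. by move=> h; elim: m => //= m IH; rewrite mulSn iterD IH. Qed.

Lemma iter_mod_fix (T : Type) (f : T -> T) p x m :
  iter p f x = x -> iter (m %% p) f x = iter m f x.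
Proof.
by move=> h; rewrite [in RHS](divn_eq m p) addnC iterD iter_mul_fix.
Qed.

Section Walks.
Local Open Scope nat_scope.
Variable n : nat.

Lemma top_ex (k : 'I_n) : {e : edge n | ea e = 0%N & eb e = (3 * k + 4)%N}.
Proof. by apply: edge_ex; have := ltn_ord k; lia. Qed.
Lemma bot_ex (k : 'I_n) : {e : edge n | ea e = (3 * k + 3)%N & eb e = (3 * k + 4)%N}.
Proof. by apply: edge_ex; have := ltn_ord k; lia. Qed.
Definition top k : edge n := s2val (top_ex k).
Definition bot k : edge n := s2val (bot_ex k).
Lemma top_a k : ea (top k) = 0%N. Proof. by rewrite /top; case: top_ex. Qed.
Lemma top_b k : eb (top k) = (3 * k + 4)%N. Proof. by rewrite /top; case: top_ex. Qed.
Lemma bot_a k : ea (bot k) = (3 * k + 3)%N. Proof. by rewrite /bot; case: bot_ex. Qed.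
Lemma bot_b k : eb (bot k) = (3 * k + 4)%N. Proof. by rewrite /bot; case: bot_ex. Qed.

Lemma etopP e : etop e -> {k | e = top k}.
Proof.
have [h1 h2 h3 h4] := edgeP e; rewrite /etop => /eqP a0.
have hk : ((eb e - 4) %/ 3 < n)%N by lia.
by exists (Ordinal hk); apply: edge_inj; rewrite ?top_a ?top_b /=; lia.
Qed.

Lemma ebotP e : ebot e -> {k | e = bot k}.
Proof.
have [h1 h2 h3 h4] := edgeP e; rewrite /ebot => /eqP a0.
have hk : ((eb e - 4) %/ 3 < n)%N by lia.
by exists (Ordinal hk); apply: edge_inj; rewrite ?bot_a ?bot_b /=; lia.
Qed.

Lemma etop_top k : etop (top k). Proof. by rewrite /etop top_a. Qed.
Lemma ebot_bot k : ebot (bot k). Proof. by rewrite /ebot bot_a bot_b; apply/eqP; lia.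
  Qed.

Definition linked (s : {perm edge n}) := [forall e, elink e (s e)].

Variable s : {perm edge n}.
Hypothesis s_linked : linked s.

Lemma link_bot k : s (bot k) = top k.
Proof.
have := forallP s_linked (bot k); rewrite /elink ebot_bot => /andP[/etopP[j ->]].
by rewrite top_b bot_b => /eqP e; congr top; apply: ord_inj; lia.
Qed.

Lemma link_step e : ~~ ebot e -> s e != e -> estep e (s e).
Proof.
move=> be se; have := forallP s_linked e; rewrite /elink (negPf be) (negPf se) /=.
by case/andP.
Qed.

Lemma link_notop e : ~~ ebot e -> ~~ etop (s e).
Proof.
by move=> be; have := forallP s_linked e; rewrite /elink (negPf be) => /andP[].
Qed.

Definition walk k t := iter t s (top k).

(** [top k] is the image of [bot k], so it is not also its own image; injectivity carries this along
    the walk. *)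
Lemma walk_moves k t : s (walk k t) != walk k t.
Proof.
elim: t => [|t IH]; last by rewrite /walk /= (inj_eq perm_inj).
rewrite /walk /= -{2}(link_bot k) (inj_eq perm_inj).
by apply/eqP => /(congr1 (@ea n)); rewrite top_a bot_a; lia.
Qed.

(** Both kinds of step raise [2 ea - eb] by 3 and [ea] by at least 1. *)
Lemma walk_level k t : (forall u, u < t -> ~~ ebot (walk k u))%N ->
  (2 * ea (walk k t) + 3 * k + 4 = eb (walk k t) + 3 * t)%N /\ (t <= ea (walk k t))%N.
Proof.
elim: t => [|t IH] h; first by rewrite /walk /= top_a top_b; lia.
have {IH} := IH (fun u ut => h u (ltnW ut)).
have := link_step (h t (ltnSn t)) (walk_moves k t); rewrite -[s _]/(walk k t.+1) /estep.
by lia.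
Qed.

Lemma walk_end k : exists j : 'I_n,
  [/\ walk k (k + j + 2) = bot j,
      forall u, (u < k + j + 2)%N -> ~~ ebot (walk k u) &
      forall u, (u <= k + j + 2)%N ->
        (2 * ea (walk k u) + 3 * k + 4 = eb (walk k u) + 3 * u)%N /\ (u <= ea (walk k
          u))%N].
Proof.
have ex : exists t, ebot (walk k t).
  (* Until a final edge is met, [t <= ea < 3 n + 3], so this range of times suffices. *)
  case: (boolP [exists t : 'I_(3 * n + 4), ebot (walk k t)]) => [/existsP[t ht]|];
    first by exists t.
  rewrite negb_exists => /forallP h.
  have /walk_level [] : forall u, (u < 3 * n + 3)%N -> ~~ ebot (walk k u).
    by move=> u un; have un' : (u < 3 * n + 4)%N; [lia|apply: (h (Ordinal un'))].
  by have [] := edgeP (walk k (3 * n + 3)); lia.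
case: (ex_minnP ex) => t bt tmin.
have nb u : (u < t)%N -> ~~ ebot (walk k u).
  by move=> ut; apply/negP => /tmin; rewrite leqNgt ut.
have [j ej] := ebotP bt; exists j.
have [e1 e2] := walk_level nb.
have et : t = (k + j + 2)%N by move: e1; rewrite ej bot_a bot_b; lia.
rewrite -et; split=> // u ut; apply: walk_level => v vu.
exact: nb (leq_trans vu ut).
Qed.

Lemma walk_b k t : ~~ ebot (walk k t) ->
  (eb (walk k t.+1) = (eb (walk k t)).+1 \/ (eb (walk k t.+1)).+1 = eb (walk k t))%N.
Proof.
move=> h; have := link_step h (walk_moves k t); rewrite -[s _]/(walk k t.+1) /estep;
  lia.
Qed.

Lemma walk_b_near k t u : (forall v, v < t + u -> ~~ ebot (walk k v))%N ->
  (eb (walk k (t + u)) <= eb (walk k t) + u)%N /\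
  (eb (walk k t) <= eb (walk k (t + u)) + u)%N.
Proof.
elim: u => [|u IH] h; first by rewrite addn0; lia.
have [] := IH (fun v vt => h v ltac:(lia)).
have /walk_b : ~~ ebot (walk k (t + u)) by apply: h; lia.
by rewrite addnS; lia.
Qed.

(* Two walks on the same level have [eb] of the same parity, and one step changes
   it by 1, so walks which do not meet keep their order. *)
Lemma walk_order (k k' : 'I_n) t : (k' < k)%N ->
  (forall u, u < t + (k - k') -> ~~ ebot (walk k u))%N ->
  (forall u, u < t -> ~~ ebot (walk k' u))%N ->
  (eb (walk k' t) < eb (walk k (t + (k - k'))))%N.
Proof.
move=> kk; set d := (k - k')%N; elim: t => [|t IH] h h'.
  have [_] := walk_b_near (t := 0) h; rewrite add0n /walk /= !top_b; lia.
have h1 := walk_level h; have h1' := walk_level h'.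
have h2 : (forall u, u < t + d -> ~~ ebot (walk k u))%N by move=> u ut; apply: h; lia.
have h2' : (forall u, u < t -> ~~ ebot (walk k' u))%N by move=> u ut; apply: h'; lia.
have l1 := walk_level h2; have l1' := walk_level h2'.
have := IH h2 h2'.
have /walk_b : ~~ ebot (walk k (t + d)) by apply: h; lia.
have /walk_b : ~~ ebot (walk k' t) by apply: h'; lia.
(* If the walks met, cancelling [t + 1] steps by injectivity would put [top k'] on the walk from
   [top k] at time [d > 0], where [ea >= d]; but [ea] is 0 at [top k']. *)
have ne : walk k (t.+1 + d) <> walk k' t.+1.
  rewrite /walk iterD.
  move=> e; have {}e : iter d s (top k) = top k'.
    by move: e; elim: (t.+1) => //= u IHu /perm_inj.
  have [] := @walk_level k d (fun u ud => h u ltac:(lia)).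
  by rewrite /walk e top_a; lia.
have nab : (eb (walk k (t.+1 + d)) = eb (walk k' t.+1) -> False)%N.
  by move=> e; apply: ne; apply: edge_inj => //; lia.
rewrite -addSn; lia.
Qed.

Lemma walk_end_mono (k k' j j' : 'I_n) : (k' < k)%N ->
  walk k (k + j + 2) = bot j -> walk k' (k' + j' + 2) = bot j' ->
  (forall u, (u < k + j + 2)%N -> ~~ ebot (walk k u)) ->
  (forall u, (u < k' + j' + 2)%N -> ~~ ebot (walk k' u)) -> (j' < j)%N.
Proof.
move=> kk e e' h h'; rewrite ltnNge; apply/negP => jj.
(* When the walk from [k] ends at [bot j], the other one has smaller [eb]. Its remaining [j' - j]
   steps raise [eb] by at most 1 each, whereas [bot j'] is [3 (j' - j)] above [bot j]. *)
have := @walk_order k k' (k' + j + 2) kk.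
have -> : (k' + j + 2 + (k - k') = k + j + 2)%N by lia.
rewrite e bot_b => /(_ h (fun u ut => h' u ltac:(lia))).
have := @walk_b_near k' (k' + j + 2) (j' - j).
have -> : (k' + j + 2 + (j' - j) = k' + j' + 2)%N by lia.
by move=> /(_ h')[]; rewrite e' bot_b; lia.
Qed.

Lemma mono_ord_id (f : 'I_n -> 'I_n) :
  (forall i j : 'I_n, i < j -> f i < f j)%N -> f =1 id.
Proof.
move=> fm.
have ge m (i : 'I_n) : nat_of_ord i = m -> (m <= f i)%N.
  elim: m i => // m IH i im; have mn : (m < n)%N by have := ltn_ord i; lia.
  have := fm (Ordinal mn) i; rewrite im ltnSn => /(_ isT).
  by have := IH (Ordinal mn) erefl; lia.
have le m (i : 'I_n) : (nat_of_ord i + m).+1 = n -> (f i + m < n)%N.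
  elim: m i => [|m IH] i im; first by have := ltn_ord (f i); lia.
  have mn : (i.+1 < n)%N by lia.
  have := fm i (Ordinal mn) (ltnSn _); have := IH (Ordinal mn); rewrite /=; lia.
move=> i; apply: ord_inj; have := ge _ i erefl; have := le (n - i.+1)%N i.
by have := ltn_ord i; lia.
Qed.

(** By [walk_end_mono] the map from starts to ends is strictly increasing on ['I_n], hence the
    identity. *)
Lemma walk_bot k : walk k (2 * k + 2) = bot k /\ forall u, (u < 2 * k + 2)%N -> ~~
  ebot (walk k u).
Proof.
have H (i : 'I_n) : exists j : 'I_n, (walk i (i + j + 2) == bot j) &&
    [forall u : 'I_(i + j + 2), ~~ ebot (walk i u)].
  have [j [e h _]] := walk_end i; exists j; rewrite e eqxx.
  by apply/forallP => u; apply: h.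
pose f i := xchoose (H i).
have fP i : walk i (i + f i + 2) = bot (f i) /\ forall u, (u < i + f i + 2)%N -> ~~
  ebot (walk i u).
  have /andP[/eqP e /forallP h] := xchooseP (H i); split=> // u ui.
  exact: (h (Ordinal ui)).
have /mono_ord_id fid : forall i j : 'I_n, (i < j -> f i < f j)%N.
  move=> i j ij; have [e h] := fP j; have [e' h'] := fP i.
  exact: (walk_end_mono ij e e' h h').
have := fP k; rewrite fid (_ : (k + k + 2 = 2 * k + 2)%N) //; lia.
Qed.

Lemma walk_period k : walk k (2 * k + 3) = top k.
Proof. by rewrite (addnS (2 * k) 2) /walk /= -/(walk k _) (walk_bot k).1 link_bot. Qed.

(** [eb - ea] decreases at each step, so a moved edge flows into a final edge and from there to an
    initial one. *)
Lemma reach_top e : s e != e -> exists k t, iter t s e = top k.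
Proof.
move: {2}(eb e - ea e)%N (leqnn (eb e - ea e)) => m; elim: m e => [|m IH] e.
  by have [] := edgeP e; lia.
move=> le se; case: (boolP (ebot e)) => be.
  by have [k ->] := ebotP be; exists k, 1%N; rewrite /= link_bot.
have h := link_step be se.
have [||k [t kt]] := IH (s e); last by exists k, t.+1; rewrite iterSr.
  by have := h; rewrite /estep; have [] := edgeP (s e); lia.
by rewrite (inj_eq perm_inj).
Qed.

Lemma iter_period e k t : iter t s e = top k -> iter (2 * k + 3) s e = e.
Proof.
move=> et; have h : iter t s (iter (2 * k + 3) s e) = iter t s e.
  by rewrite -iterD (addnC t) iterD et -/(walk _ _) walk_period.
by elim: t h {et} => //= t IH /perm_inj.
Qed.

Lemma on_walk e : s e != e -> exists (k : 'I_n) t, (t < 2 * k + 3)%N /\ e = walk k t.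
Proof.
(* On a cycle of length [2 k + 3], going back [t] steps is going forward [t (2 k + 2)] steps. *)
case/reach_top => k [t et]; exists k, ((t * (2 * k + 2)) %% (2 * k + 3))%N; split.
  by apply: ltn_pmod; lia.
have per m := iter_mul_fix m (iter_period et).
rewrite /walk (iter_mod_fix _ (walk_period k)) -et -iterD -{1}(per t); congr iter; lia.
Qed.

(* The cycle through [top k] has odd length [2 k + 3]. *)
Lemma linked_odd : exists2 m, odd m & forall e, iter m s e = e.
Proof.
exists (\prod_(k < n) (2 * k + 3))%N.
  elim/big_ind: _ => //= [x y ox oy|i _]; first by rewrite oddM ox.
  by rewrite oddD oddM.
move=> e; case: (eqVneq (s e) e) => [se|/reach_top[k [t et]]].
  by elim: (\prod_(_ < n) _)%N => //= m ->.
by rewrite (bigD1 k) //= (mulnC (2 * k + 3)); apply: iter_mul_fix (iter_period et).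
Qed.
End Walks.

Definition linked_perms n : {set {perm edge n}} := [set s | linked s]%SET.

Lemma det_elink_count (R : comPzRingType) n :
  (\det (mxf (fun e f : edge n => (elink e f)%:R : R)) =
  #|linked_perms n|%:R)%R.
Proof. by rewrite det_mxf_rel // => s /forallP; apply: linked_odd. Qed.

(** * The determinant of binomial coefficients *)

Definition npaths (dx dy : int) : int :=
  match dx, dy with Posz a, Posz b => 'C(a + b, a)%:Z | _, _ => 0 end.

Lemma npaths_neg dx dy : (dx < 0) || (dy < 0) -> npaths dx dy = 0.
Proof. by case: dx => [a|a]; case: dy => [b|b]. Qed.

Lemma npaths_pascal dx dy : (dx != 0) || (dy != 0) ->
  npaths dx dy = npaths (dx - 1) dy + npaths dx (dy - 1).
Proof.
case: dx => [[|a]|a]; case: dy => [[|b]|b] //= _; rewrite ?subn1 /=.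
- by rewrite !bin0.
- by rewrite !addn0 !binn.
by rewrite -PoszD addSn binS addnS addSn addnC.
Qed.

Lemma npaths_binz dx dy N : dx + dy = N%:Z -> npaths dx dy = binz N dx.
Proof.
case: dx => a; case: dy => b //= e; first by congr (Posz 'C(_, _)); lia.
by rewrite bin_small //; lia.
Qed.

Section DetD.
Variable n : nat.

Definition py (e : edge n) : int := ((ea e + eb e) %/ 3)%N%:Z - 1.
Definition px (e : edge n) : int := py e + 2 * n%:Z + 2 - (eb e)%:Z.

(* The reflection in the line y = x + n + 1 maps (x, y) to (y - n - 1, x + n + 1). *)
Definition npaths_below (j : 'I_n) (x y : int) : int :=
  let B := Qend n j.+1 in
  npaths (B.1 - x) (B.2 - y) - npaths (B.1 - (y - n%:Z - 1)) (B.2 - (x + n%:Z + 1)).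

Lemma npaths_below_wall (j : 'I_n) (x y : int) : y = x + n%:Z + 1 -> npaths_below j x
  y = 0.
Proof.
move=> ->; rewrite /npaths_below /=; apply/eqP; rewrite subr_eq0; apply/eqP.
by congr npaths; lia.
Qed.

(** The end points lie on the line [2 x + y = 4 n - 1]; from the next such line neither the point
    nor its reflection can reach them. *)
Lemma npaths_below_out (j : 'I_n) (x y : int) : 2 * x + y = 4 * n%:Z -> y <= x + n%:Z ->
  npaths_below j x y = 0.
Proof.
by move=> e1 e2; have := ltn_ord j; rewrite /npaths_below /= !npaths_neg //; lia.
Qed.

Lemma npaths_below_pascal (j : 'I_n) (x y : int) : y <= x + n%:Z -> (x, y) != Qend n
  j.+1 ->
  npaths_below j x y = npaths_below j (x + 1) y + npaths_below j x (y + 1).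
Proof.
move=> e1 e2; have := ltn_ord j => jn; rewrite /npaths_below /=.
rewrite npaths_pascal; last first.
  by rewrite -negb_and; apply: contra e2 => /andP[]; rewrite !subr_eq0 => /eqP h1
    /eqP h2; rewrite -h1 -h2.
(* The reflected point lies above the line [y = x + n], so it is not the end point. *)
rewrite [npaths (_ - (y - _ - _)) _]npaths_pascal; last by lia.
have E a b c d : a = c -> b = d -> npaths a b = npaths c d by move=> -> ->.
rewrite (E (_ - x - 1) _ (n%:Z + j.+1%:Z - 1 - (x + 1)) _ _ erefl); last by lia.
rewrite (E _ (_ - y - 1) _ (2 * n%:Z + 1 - 2 * j.+1%:Z - (y + 1)) erefl); last by lia.
rewrite (E _ (_ - (x + _ + _) - 1) _ (2 * n%:Z + 1 - 2 * j.+1%:Z - (x + 1 + n%:Z +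
  1)) erefl); last by lia.
rewrite (E (_ - (y - _ - _) - 1) _ (n%:Z + j.+1%:Z - 1 - (y + 1 - n%:Z - 1)) _ _
  erefl); last by lia.
ring.
Qed.

Definition start_edge (i : 'I_n) := top (rev_ord i).
Definition end_edge (i : 'I_n) := bot (rev_ord i).

Lemma start_edge_xy i : px (start_edge i) = (Qstart n i.+1).1 /\ py (start_edge i) =
  (Qstart n i.+1).2.
Proof. by rewrite /px /py /start_edge top_a top_b /=; have := ltn_ord i; split; lia.
  Qed.
Lemma end_edge_xy i : px (end_edge i) = (Qend n i.+1).1 /\ py (end_edge i) = (Qend n
  i.+1).2.
Proof. by rewrite /px /py /end_edge bot_a bot_b /=; have := ltn_ord i; split; lia. Qed.

Lemma edge_xyP (e : edge n) : [/\ py e <= px e + n%:Z,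
   2 * py e = (ea e)%:Z - px e + 2 * n%:Z - 2 &
   2 * px e + py e = 4 * n%:Z + (ea e)%:Z - (eb e)%:Z ].
Proof. by have [h1 h2 h3 h4] := edgeP e; split; rewrite /px /py; lia. Qed.

Lemma xy_inj (e f : edge n) : px e = px f -> py e = py f -> e = f.
Proof.
have [h1 h2 h3 h4] := edgeP e; have [h1' h2' h3' h4'] := edgeP f.
by rewrite /px /py => e1 e2; apply: edge_inj; lia.
Qed.

Lemma npaths_below_start i j :
  npaths_below j (px (start_edge i)) (py (start_edge i)) = Dentry n i.+1 j.+1.
Proof.
have [-> ->] := start_edge_xy i.
rewrite /npaths_below /Dentry /=; have := ltn_ord i; have := ltn_ord j => h1 h2.
rewrite !(@npaths_binz _ _ (2 * n + 2 - (i.+1 + j.+1))%N); try lia.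
by congr (_ - _); [congr binz; lia|have -> : n%:Z + j.+1%:Z - 1 - (n%:Z - i.+1%:Z -
  n%:Z - 1) = (n + i.+1 + j.+1)%N by lia].
Qed.

Lemma npaths_below_end i j :
  npaths_below j (px (end_edge i)) (py (end_edge i)) = (i == j)%:R.
Proof.
have [-> ->] := end_edge_xy i.
have := ltn_ord i; have := ltn_ord j => h1 h2.
rewrite /npaths_below /= [X in _ - X]npaths_neg; last by lia.
rewrite subr0; have [->|ne] := eqVneq i j; first by rewrite !subrr.
by rewrite npaths_neg //; have : (i != j :> nat) by []; lia.
Qed.

(* [elink] without the condition [~~ etop f], which holds automatically for
   permutations; its matrix is a perturbation of rank n of a unitriangular one. *)
Definition elink1 (e f : edge n) :=
  if ebot e then etop f && (eb f == eb e) else (f == e) || estep e f.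

(** Every initial edge is already the image of a final one, so by injectivity no other edge is sent
    to it. *)
Lemma elink1_linked (s : {perm edge n}) :
  [forall e, elink1 e (s e)] = linked s.
Proof.
apply/forallP/forallP => h e; have := h e; rewrite /elink1 /elink; case: ifP => //
  be; last by case/andP.
have [t|//] := boolP (etop (s e)); rewrite /= => /orP[/eqP se|]; last first.
  by move: t; rewrite /etop /estep; lia.
rewrite se in t; have [k ek] := etopP t.
have := h (bot k); rewrite /elink1 ebot_bot => /andP[/etopP[j ej]].
rewrite ej top_b bot_b => jk; have {}jk : j = k by apply: ord_inj; lia.
have : s (bot k) = s e by rewrite se ej jk ek.
by move/perm_inj => e1; rewrite -e1 ebot_bot in be.
Qed.

Lemma det_elink1 : \det (mxf (fun e f => (elink1 e f)%:R : int)) =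
  #|linked_perms n|%:Z.
Proof.
rewrite det_mxf_rel => [|s /forallP]; last by rewrite elink1_linked; apply: linked_odd.
by rewrite natz; congr Posz; apply: eq_card => s; rewrite !inE elink1_linked.
Qed.

Definition eflow (e f : edge n) := (f == e) || estep e f.

(** A moved edge has all its orbit moved, with [ea] rising forever, although [ea] is bounded. *)
Lemma eflow_perm (s : {perm edge n}) e : (forall x, eflow x (s x)) -> s e = e.
Proof.
move=> h; apply/eqP; apply: contraT => se.
have h2 t : (t <= ea (iter t s e))%N /\ s (iter t s e) != iter t s e.
  elim: t => // t [IH1 IH2]; rewrite iterS; split; last by rewrite (inj_eq perm_inj).
  by have := h (iter t s e); rewrite /eflow (negPf IH2) /= /estep; case/orP =>
    /andP[/eqP -> _]; rewrite ltnS ?leqW //.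
have [h3 _] := h2 (3 * n + 3)%N.
by have [h1 _ h4 _] := edgeP (iter (3 * n + 3) s e); lia.
Qed.

Lemma det_eflow : \det (mxf (fun e f => (eflow e f)%:R : int)) = 1.
Proof.
rewrite det_mxf_rel => [|s h]; last by exists 1%N => // e; apply: eflow_perm.
rewrite (_ : [set _ | _]%SET = [set 1%g]%SET) ?cards1 //.
apply/setP => s; rewrite !inE; apply/forallP/eqP => [h|-> e].
  by apply/permP => e; rewrite perm1 eflow_perm.
by rewrite perm1 /eflow eqxx.
Qed.

Definition parity_sign (m : nat) : int := (-1) ^+ m.

Lemma parity_signD m k : parity_sign (m + k) = parity_sign m * parity_sign k.
Proof. by rewrite /parity_sign exprD. Qed.
Lemma parity_signS m : parity_sign m.+1 = - parity_sign m.
Proof. by rewrite /parity_sign exprS mulN1r. Qed.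
Lemma parity_sign_sq m : parity_sign m * parity_sign m = 1.
Proof. by rewrite -parity_signD addnn /parity_sign -mul2n exprM sqrrN expr1n ?expr1n.
  Qed.

Let h (e : edge n) (j : 'I_n) : int := npaths_below j (px e) (py e).

(** A step changes [eb] by 1, so the signs turn the sum into the difference of the two sides of the
    Pascal recurrence, which fails only at the end point. *)
Lemma flow_npaths e j :
  \sum_f (eflow e f)%:R * (parity_sign (eb f) * h f j) = (e == end_edge j)%:R *
    parity_sign (eb e).
Proof.
have [a1 a2 a3 a4] := edgeP e; have [x1 x2 x3] := edge_xyP e.
rewrite (bigD1 e) //= {1}/eflow eqxx mul1r.
case: (boolP (ebot e)) => be.
  rewrite big1 ?addr0 => [|f fe]; last first.
    rewrite /eflow (negPf fe) /=; move: be; rewrite /ebot => /eqP be.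
    case: (boolP (estep e f)); rewrite ?mul0r // /estep; have [] := edgeP f; lia.
  have [k ->] := ebotP be; rewrite -[k]rev_ordK -/(end_edge _) /h npaths_below_end
    mulrC.
  congr (_%:R * _); congr nat_of_bool.
  by apply/eqP/eqP => [->//|/(congr1 (@ea n))]; rewrite !bot_a => e1; apply:
    rev_ord_inj; apply: ord_inj; lia.
have -> : e == end_edge j = false by apply: contraNF be => /eqP ->; rewrite ebot_bot.
rewrite mul0r.
have be' : (eb e != (ea e).+1)%N by [].
have pas : h e j = npaths_below j (px e + 1) (py e) + npaths_below j (px e) (py e + 1).
  apply: npaths_below_pascal => //; apply/eqP => e1.
  have [e2 e3] := end_edge_xy j; case/negP: be.
  have -> : e = end_edge j by apply: xy_inj; rewrite ?e2 ?e3 -e1.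
  by rewrite ebot_bot.
pose f1 := [pred f : edge n | (ea f == (ea e).+1) && ((eb f).+1 == eb e)].
pose f2 := [pred f : edge n | (ea f == (ea e).+2) && (eb f == (eb e).+1)].
have S1 : \sum_(f | f != e) (f1 f)%:R * (parity_sign (eb f) * h f j) =
    - parity_sign (eb e) * npaths_below j (px e + 1) (py e).
  have [v|v] := leqP (eb e) (ea e + 2)%N.
    (* The neighbour is missing past the line of the end points, where the count is 0. *)
    rewrite npaths_below_out; [|lia|lia].
    rewrite mulr0 big1 // => f _; rewrite /f1 /=; have [] := edgeP f.
    by case: andP => [[]|]; rewrite ?mul0r //; lia.
  have [f fa fb] : {f : edge n | ea f = (ea e).+1 & eb f = (eb e).-1} by apply:
    edge_ex; lia.
  have fe : f != e by apply/eqP => fe; move: fa; rewrite fe; lia.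
  rewrite (bigD1 f) //= big1 ?addr0 => [|g /andP[_ gf]]; last first.
    case: andP => [[/eqP g1 /eqP g2]|]; rewrite ?mul0r //.
    by case/eqP: gf; apply: edge_inj; lia.
  rewrite fa fb eqxx prednK ?eqxx /=; last by lia.
  rewrite mul1r; have -> : eb e = (eb e).-1.+1 by lia.
  rewrite parity_signS opprK; congr (_ * _); rewrite /h; congr npaths_below.
    by rewrite /px /py fa fb; lia.
  by rewrite /px /py fa fb; lia.
have S2 : \sum_(f | f != e) (f2 f)%:R * (parity_sign (eb f) * h f j) =
    - parity_sign (eb e) * npaths_below j (px e) (py e + 1).
  have [v|v] := leqP (3 * n + 3)%N (eb e).+1.
    (* The neighbour is missing on the line [y = x + n + 1], where a count and its reflection
       cancel. *)
    rewrite npaths_below_wall; last by rewrite /px; lia.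
    rewrite mulr0 big1 // => f _; rewrite /f2 /=; have [] := edgeP f.
    by case: andP => [[]|]; rewrite ?mul0r //; lia.
  have [f fa fb] : {f : edge n | ea f = (ea e).+2 & eb f = (eb e).+1} by apply:
    edge_ex; lia.
  have fe : f != e by apply/eqP => fe; move: fa; rewrite fe; lia.
  rewrite (bigD1 f) //= big1 ?addr0 => [|g /andP[_ gf]]; last first.
    case: andP => [[/eqP g1 /eqP g2]|]; rewrite ?mul0r //.
    by case/eqP: gf; apply: edge_inj; lia.
  rewrite fa fb !eqxx /= mul1r parity_signS; congr (_ * _); rewrite /h; congr
    npaths_below.
    by rewrite /px /py fa fb; lia.
  by rewrite /px /py fa fb; lia.
have -> : \sum_(f | f != e) (eflow e f)%:R * (parity_sign (eb f) * h f j) =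
   \sum_(f | f != e) ((f1 f)%:R * (parity_sign (eb f) * h f j) + (f2 f)%:R *
     (parity_sign (eb f) * h f j)).
  apply: eq_bigr => f fe; rewrite -mulrDl -natrD /eflow (negPf fe) /= /estep.
  by congr (_%:R * _); lia.
rewrite big_split /= S1 S2 pas; ring.
Qed.

(** The matrix of [elink1] is [L + U V = L (1 + X V)] with [det L = 1], and [sylvester] reduces
    [1 + X V] to the [n x n] matrix [1 + V X]. There the end edges cancel the identity and the start
    edges give [Dmx n], conjugated by signs. *)
Lemma det_Dmx : \det (Dmx n) = #|linked_perms n|%:Z.
Proof.
pose L : 'M[int]_#|{: edge n}| := mxf (fun e f => (eflow e f)%:R).
pose X : 'M[int]_(#|{: edge n}|, n) :=
  \matrix_(i, j) (parity_sign (eb (enum_val i)) * h (enum_val i) j * parity_sign (eb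
    (end_edge j))).
pose U : 'M[int]_(#|{: edge n}|, n) := \matrix_(i, j) (enum_val i == end_edge j)%:R.
pose V : 'M[int]_(n, #|{: edge n}|) :=
  \matrix_(j, i) ((enum_val i == start_edge j)%:R - (enum_val i == end_edge j)%:R).
have LX : L *m X = U.
  apply/matrixP => i j; rewrite !mxE.
  have -> : \sum_k L i k * X k j = (\sum_f (eflow (enum_val i) f)%:R * (parity_sign
    (eb f) * h f j)) * parity_sign (eb (end_edge j)).
    rewrite mulr_suml [RHS](reindex _ (onW_bij _ (enum_val_bij (edge n)))) /=.
    by apply: eq_bigr => k _; rewrite !mxE !mulrA.
  rewrite flow_npaths -mulrA; case: eqP => [->|]; last by rewrite mul0r.
  by rewrite parity_sign_sq mulr1.
have K1 : mxf (fun e f => (elink1 e f)%:R : int) = L + U *m V.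
  apply/matrixP => i j; rewrite !mxE; under eq_bigr do rewrite !mxE.
  move: (enum_val i) (enum_val j) => e f {i j}; rewrite /elink1.
  case: (boolP (ebot e)) => be; last first.
    rewrite big1 ?addr0 // => k _; case: eqP => [ek|]; rewrite ?mul0r //.
    by rewrite ek ebot_bot in be.
  have [k0 ek0] := ebotP be; have ek : e = end_edge (rev_ord k0) by rewrite /end_edge
    rev_ordK.
  have Bot_inj : injective end_edge.
    move=> k k' /(congr1 (@ea n)); rewrite !bot_a => e1.
    by apply: rev_ord_inj; apply: ord_inj; lia.
  rewrite (bigD1 (rev_ord k0)) //= big1 ?addr0 => [|k kk]; last first.
    by rewrite ek (inj_eq Bot_inj) eq_sym (negPf kk) mul0r.
  rewrite -ek eqxx mul1r.
  have -> : eflow e f = (f == e).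
    rewrite /eflow; case: (f == e) => //=; apply/negbTE; move: be.
    by rewrite /ebot /estep; have [] := edgeP f; lia.
  rewrite addrCA subrr addr0; congr (nat_of_bool _)%:R; rewrite /start_edge rev_ordK
    ek0 bot_b.
  apply/andP/eqP => [[/etopP[k ->] /eqP]|->]; last by rewrite etop_top top_b.
  by rewrite top_b => e1; congr top; apply: ord_inj; lia.
rewrite -det_elink1 K1 -LX -{1}[L]mulmx1 -mulmxA -mulmxDr det_mulmx det_eflow mul1r.
have := sylvester 1 X V; rewrite !expr1n !mul1r => ->.
pose S : 'rV[int]_n := \row_i parity_sign (eb (end_edge i)).
have -> : 1%:M + V *m X = diag_mx S *m Dmx n *m diag_mx S.
  apply/matrixP => i j; rewrite mul_mx_diag mul_diag_mx !mxE.
  have pick f : \sum_k (enum_val k == f)%:R * X k j = parity_sign (eb f) * h f j *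
    parity_sign (eb (end_edge j)).
    rewrite (bigD1 (enum_rank f)) //= enum_rankK eqxx mul1r big1 ?addr0 ?mxE
      ?enum_rankK // => k kf.
    by rewrite (can2_eq enum_valK enum_rankK) (negPf kf) mul0r.
  under eq_bigr do rewrite mxE mulrBl.
  rewrite big_split /= sumrN !pick /h npaths_below_start npaths_below_end.
  have -> : eb (start_edge i) = eb (end_edge i) by rewrite top_b bot_b.
  case: eqP => [<-|_]; last by rewrite mulr0 mul0r subr0 add0r.
  by rewrite mulr1n mulr1 parity_sign_sq addrCA subrr addr0.
rewrite !det_mulmx det_diag mulrC mulrA -big_split /= big1 ?mul1r // => i _.
by rewrite !mxE parity_sign_sq.
Qed.
End DetD.

(** * Lozenge tilings *)

Lemma card_eq_bij (F : finType) (P : {set F}) (U : Type) (A : set U) (f : F -> U) :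
  {in P &, injective f} -> (forall x, x \in P -> A (f x)) ->
  (forall u, A u -> exists2 x, x \in P & f x = u) -> A #= `I_#|P|.
Proof.
move=> fi fA Af; have -> : A = f @` [set` P].
  apply/seteqP; split=> [u /Af[x xP <-]|_ [x xP <-]]; last exact: fA.
  by exists x.
have h : f @` [set` P] #= [set` P].
  by apply: inj_card_eq => x y; rewrite !inE => xP yP; apply: fi.
apply: card_eq_trans h _; apply/card_set_bijP; exists (fun x => index x (enum P)).
split=> [x xP|x y|i].
- by rewrite /= cardE index_mem mem_enum.
- rewrite !inE => xP yP e.
  have hx : x \in enum P by rewrite mem_enum.
  have hy : y \in enum P by rewrite mem_enum.
  by rewrite -(nth_index x hx) e nth_index.
move=> iP; case: (pickP (mem P)) => [x0 _|P0].
  exists (nth x0 (enum P) i).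
    by rewrite /= -mem_enum mem_nth // -cardE.
  by rewrite index_uniq ?enum_uniq // -cardE.
by move: iP; rewrite /= eq_card0.
Qed.

Lemma eis_center a b :
  (one_eis - omega) *+ a + (one_eis - omega_sq) *+ b = (a%:Z + 2 * b%:Z, b%:Z - a%:Z).
Proof.
have E (p q : int * int) : p.1 = q.1 -> p.2 = q.2 -> p = q by case: p q => [? ?] [?
  ?] /= -> ->.
have M1 (p : eisenstein) k : (p *+ k).1 = p.1 * k%:Z.
  by elim: k => [|k IH]; rewrite ?mulrS ?mulr0 //= IH; lia.
have M2 (p : eisenstein) k : (p *+ k).2 = p.2 * k%:Z.
  by elim: k => [|k IH]; rewrite ?mulrS ?mulr0 //= IH; lia.
by apply: E; rewrite /= ?M1 ?M2 /=; lia.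
Qed.

Lemma vertices_up x y : vertices ((x, y), true) =
  [:: (x, y); (x + 1, y); (x + 1, y + 1)].
Proof.
rewrite /vertices /=; congr [:: _; _; _]; apply/eqP; rewrite xpair_eqE /=; lia.
Qed.

Lemma vertices_dn x y : vertices ((x, y), false) =
  [:: (x, y); (x, y + 1); (x + 1, y + 1)].
Proof.
rewrite /vertices /=; congr [:: _; _; _]; apply/eqP; rewrite xpair_eqE /=; lia.
Qed.

Lemma share_edge_translate (z w : eisenstein) b c :
  share_edge (z, b) (z + w, c) = share_edge (0, b) (w, c).
Proof.
have V (u : eisenstein) d : vertices (z + u, d) = map (+%R z) (vertices (u, d)).
  by rewrite /vertices; case: d; rewrite /= !addrA.
have V0 : vertices (z, b) = map (+%R z) (vertices (0, b)) by rewrite -V addr0.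
rewrite /share_edge V V0 count_map; congr (_ == _).
by apply: eq_count => u /=; rewrite (mem_map (addrI z)).
Qed.

Lemma share_edge_sym t t' : share_edge t t' = share_edge t' t.
Proof.
have U t0 : uniq (vertices t0).
  case: t0 => [[x y] []]; rewrite ?vertices_up ?vertices_dn /= !inE !xpair_eqE; lia.
rewrite /share_edge; congr (_ == _); rewrite -!size_filter.
apply/eqP; rewrite eqn_leq !uniq_leq_size ?filter_uniq // => u;
  by rewrite !mem_filter /= andbC.
Qed.

Lemma share_dn_up (u v : int) : share_edge (0, false) ((u, v), true) =
  [|| (u == 0) && (v == 0), (u == 0) && (v == 1) | (u == -1) && (v == 0)].
Proof.
rewrite /share_edge vertices_up vertices_dn.
by case: u => [[|[|u]]|[|u]]; case: v => [[|[|v]]|[|v]].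
Qed.

Lemma share_same (z w : eisenstein) b : share_edge (z, b) (w, b) = false.
Proof.
rewrite -[w](subrK z) addrC share_edge_translate; case: (w - z) => u v.
rewrite /share_edge; case: b; rewrite ?vertices_up ?vertices_dn;
  by case: u => [[|[|u]]|[|u]]; case: v => [[|[|v]]|[|v]].
Qed.

Section Tilings.
Variable n : nat.
Hypothesis n_gt0 : (0 < n)%N.

(* The triangles on both sides of an edge, in the coordinates of [triangle]. *)
Definition cy (e : edge n) : int := ((ea e + eb e) %/ 3)%N%:Z - (ea e)%:Z - 1.
Definition cx (e : edge n) : int := (ea e)%:Z + 2 * cy e.
Definition tri_dn (e : edge n) : triangle := ((cx e, cy e), false).
Definition tri_up (e : edge n) : triangle := ((cx e, cy e + 1), true).

Lemma cxyP (e : edge n) : (ea e)%:Z = cx e - 2 * cy e /\ (eb e)%:Z = 4 + 2 * cx e -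
  cy e.
Proof. by have [h1 h2 h3 h4] := edgeP e; rewrite /cx /cy; lia. Qed.

Lemma tri_dn_inj : injective tri_dn.
Proof.
move=> e f [ex ey]; have [h1 h2] := cxyP e; have [h3 h4] := cxyP f.
by apply: edge_inj; lia.
Qed.

Lemma tri_up_inj : injective tri_up.
Proof.
move=> e f [ex ey]; have [h1 h2] := cxyP e; have [h3 h4] := cxyP f.
by apply: edge_inj; lia.
Qed.

Lemma regionE t : region n t <-> exists a b : nat, (a + b <= n.-1)%N /\
  (a%:Z + 2 * b%:Z, b%:Z - a%:Z) \in vertices t.
Proof.
by split=> -[a [b [h1 h2]]]; exists a, b; split=> //; move: h2; rewrite eis_center.
Qed.

Lemma region_dn e : ~~ ebot e -> region n (tri_dn e).
Proof.
move=> be; apply/regionE; have [h1 h2 h3 h4] := edgeP e; have [h5 h6] := cxyP e.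
have be' : eb e <> (ea e).+1 by apply/eqP.
rewrite /tri_dn vertices_dn.
(* Hexagon centres have coordinate sum 0 mod 3, so exactly one vertex of the triangle can be a
   centre; the residue of [ea e] selects it. *)
have [r|[r|r]] : (ea e %% 3 = 0 \/ ea e %% 3 = 1 \/ ea e %% 3 = 2)%N by lia.
- exists (ea e %/ 3)%N, ((eb e - ea e - 4) %/ 3)%N; split; first lia.
  by rewrite !inE !xpair_eqE; lia.
- exists ((ea e - 1) %/ 3)%N, ((eb e - ea e - 2) %/ 3)%N; split; first lia.
  by rewrite !inE !xpair_eqE; lia.
exists ((ea e - 2) %/ 3)%N, ((eb e - ea e - 3) %/ 3)%N; split; first lia.
by rewrite !inE !xpair_eqE; lia.
Qed.

Lemma region_up e : ~~ etop e -> region n (tri_up e).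
Proof.
move=> te; apply/regionE; have [h1 h2 h3 h4] := edgeP e; have [h5 h6] := cxyP e.
have te' : ea e <> 0%N by apply/eqP.
rewrite /tri_up vertices_up.
have [r|[r|r]] : (ea e %% 3 = 0 \/ ea e %% 3 = 1 \/ ea e %% 3 = 2)%N by lia.
- exists ((ea e - 3) %/ 3)%N, ((eb e - ea e - 1) %/ 3)%N; split; first lia.
  by rewrite !inE !xpair_eqE; lia.
- exists ((ea e - 1) %/ 3)%N, ((eb e - ea e - 2) %/ 3)%N; split; first lia.
  by rewrite !inE !xpair_eqE; lia.
exists ((ea e - 2) %/ 3)%N, ((eb e - ea e - 3) %/ 3)%N; split; first lia.
by rewrite !inE !xpair_eqE; lia.
Qed.

Lemma region_dnP z : region n (z, false) -> exists2 e, ~~ ebot e & tri_dn e = (z,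
  false).
Proof.
case: z => x y /regionE [a [b [ab]]]; rewrite vertices_dn !inE !xpair_eqE => h.
have [p ep] : exists p : nat, x - 2 * y = p%:Z by exists (absz (x - 2 * y)%R); lia.
have [q eq] : exists q : nat, 4 + 2 * x - y = q%:Z by exists (absz (4 + 2 * x -
  y)%R); lia.
have [e e1 e2] : {e : edge n | ea e = p & eb e = q} by apply: edge_ex; lia.
exists e; first by rewrite /ebot e1 e2; lia.
by have [h1 h2] := cxyP e; rewrite /tri_dn; congr (_, _, _); lia.
Qed.

Lemma region_upP z : region n (z, true) -> exists2 e, ~~ etop e & tri_up e = (z, true).
Proof.
case: z => x y /regionE [a [b [ab]]]; rewrite vertices_up !inE !xpair_eqE => h.
have [p ep] : exists p : nat, x - 2 * (y - 1) = p%:Z by exists (absz (x - 2 * (y -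
  1))%R); lia.
have [q eq] : exists q : nat, 4 + 2 * x - (y - 1) = q%:Z by exists (absz (4 + 2 * x -
  (y - 1))%R); lia.
have [e e1 e2] : {e : edge n | ea e = p & eb e = q} by apply: edge_ex; lia.
exists e; first by rewrite /etop e1; lia.
by have [h1 h2] := cxyP e; rewrite /tri_up; congr (_, _, _); lia.
Qed.

Lemma share_edges e f : share_edge (tri_dn e) (tri_up f) = (f == e) || estep e f.
Proof.
pose w : eisenstein := (cx f - cx e, cy f + 1 - cy e).
have [h1 h2] := cxyP e; have [h3 h4] := cxyP f.
have -> : tri_up f = ((cx e, cy e) + w, true).
  rewrite /tri_up; congr (_, true); rewrite [RHS]surjective_pairing /=; congr pair; lia.
rewrite share_edge_translate share_dn_up.
have -> : (f == e) = (ea f == ea e) && (eb f == eb e).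
  by apply/eqP/andP => [-> //|[/eqP g1 /eqP g2]]; apply: edge_inj.
by rewrite /estep; lia.
Qed.

(** Final edges are left out because they carry no downward triangle; a fixed point of [s] gives the
    lozenge on both sides of its edge. *)
Definition lozenges (s : {perm edge n}) : set (set triangle) :=
  [set L | exists2 e, ~~ ebot e & L = [set tri_dn e; tri_up (s e)]].

Lemma lozenges_tiling s : linked s -> lozenge_tilings n (lozenges s).
Proof.
move=> sl; split=> [_ [e be ->]|[z []] rt].
- split.
    exists (tri_dn e), (tri_up (s e)); split=> //; rewrite share_edges.
    by have [//|se] := eqVneq (s e) e; rewrite (link_step sl be se) orbT.
  by move=> _ [->|->]; [apply: region_dn|apply/region_up/link_notop].
- have [f tf ef] := region_upP rt.
  have sf : s ((s^-1)%g f) = f by rewrite permKV.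
  have bf : ~~ ebot ((s^-1)%g f).
    by apply/negP => /ebotP[k bk]; move: tf; rewrite -sf bk link_bot // etop_top.
  exists [set tri_dn ((s^-1)%g f); tri_up f]; split.
    by split; [exists ((s^-1)%g f); rewrite ?sf|right].
  move=> _ [[e be ->] []]; rewrite -ef // => /tri_up_inj ->.
  by rewrite permK.
have [e be ee] := region_dnP rt.
exists [set tri_dn e; tri_up (s e)]; split; first by split; [exists e|left].
by move=> _ [[f bf ->] []]; rewrite -ee // => /tri_dn_inj ->.
Qed.

Lemma lozenges_inj : {in linked_perms n &, injective lozenges}.
Proof.
move=> s s'; rewrite !inE => sl sl' ss; apply/permP => e.
case: (boolP (ebot e)) => [/ebotP[k ->]|be]; first by rewrite !link_bot.
have : lozenges s' [set tri_dn e; tri_up (s e)] by rewrite -ss; exists e.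
case=> f bf /seteqP [h1 h2].
have := h1 _ (or_introl erefl); case=> // /tri_dn_inj ef; subst f.
by have := h1 _ (or_intror erefl); case=> // /tri_up_inj.
Qed.

Lemma lozenges_surj S : lozenge_tilings n S ->
  exists2 s, s \in linked_perms n & lozenges s = S.
Proof.
move=> [Sl Su].
have dn_ex e : ~~ ebot e -> exists f, [/\ S [set tri_dn e; tri_up f], ~~ etop f & (f
  == e) || estep e f].
  move=> be; have [L [[SL Le] _]] := Su _ (region_dn be).
  have [[t [t' [tt' eL]]] Lr] := Sl _ SL.
  have [t2 [e2 s2]] : exists t2, L = [set tri_dn e; t2] /\ share_edge (tri_dn e) t2.
    move: Le; rewrite eL => -[->|->]; first by exists t'.
    by exists t; rewrite setUC; split=> //; rewrite share_edge_sym.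
  have : region n t2 by apply: Lr; rewrite e2; right.
  case: t2 e2 s2 => z [] e2 s2; last by rewrite share_same in s2.
  move=> /region_upP[f tf ef]; exists f; split=> //; first by rewrite ef -e2.
  by rewrite -share_edges ef.
pose P e f := if ebot e then etop f && (eb f == eb e) : Prop
  else [/\ S [set tri_dn e; tri_up f], ~~ etop f & (f == e) || estep e f].
have exP e : exists f, P e f.
  rewrite /P; case: (boolP (ebot e)) => [/ebotP[k ->]|/dn_ex //].
  by exists (top k); rewrite etop_top top_b bot_b eqxx.
pose g e := projT1 (cid (exP e)).
have gP e : P e (g e) by rewrite /g; case: cid.
(* For two non-final edges this is the uniqueness of the lozenge covering an upward triangle. *)
have gi : injective g.
  move=> e e' ee; have := gP e; have := gP e'; rewrite -ee /P.
  case: (boolP (ebot e)) => be; case: (boolP (ebot e')) => be'.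
  - move=> /andP[_ /eqP h1] /andP[_ /eqP h2]; move: be be'; rewrite /ebot => /eqP h3
    /eqP h4.
    by apply: edge_inj; lia.
  - by move=> [_ /negP h _] /andP[].
  - by move=> /andP[h _] [_ /negP].
  move=> [S1 t1 _] [S2 _ _]; have [L [_ uL]] := Su _ (region_up t1).
  have e1 := uL _ (conj S1 (or_intror erefl)).
  have e2 := uL _ (conj S2 (or_intror erefl)).
  have : [set tri_dn e'; tri_up (g e)] (tri_dn e) by rewrite -e1 e2; left.
  by case=> // /tri_dn_inj.
exists (perm gi).
  rewrite inE; apply/forallP => e; rewrite permE /elink.
  by have := gP e; rewrite /P; case: ifP => // _ [_ -> ->].
apply/seteqP; split=> [_ [e be ->]|L SL].
  by rewrite permE; have := gP e; rewrite /P (negPf be) => -[].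
have [[t [t' [tt' eL]]] Lr] := Sl _ SL.
have [z [t2 e2]] : exists z t2, L = [set (z, false); t2].
  move: tt' eL; case: t => z []; case: t' => z' []; rewrite ?share_same // => _ ->.
    by exists z', (z, true); rewrite setUC.
  by exists z, (z', true).
have rz : region n (z, false) by apply: Lr; rewrite e2; left.
have [e be ee] := region_dnP rz; exists e => //; rewrite permE.
have [L' [_ uL]] := Su _ rz.
rewrite -(uL L); last by split=> //; rewrite e2; left.
apply: uL; have := gP e; rewrite /P (negPf be) => -[h _ _].
by split=> //; rewrite -ee; left.
Qed.

Lemma card_lozenge_tilings :
  lozenge_tilings n #= `I_#|linked_perms n|.
Proof.
apply: (card_eq_bij lozenges_inj) => [s|S]; first by rewrite inE; apply:
  lozenges_tiling.
exact: lozenges_surj.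
Qed.
End Tilings.

(** * Lattice paths *)

Section Paths.
Variable n : nat.

Definition edge_point (e : edge n) : Defs.point := (px e, py e).

Lemma edge_point_inj : injective edge_point.
Proof. by move=> e f [h1 h2]; apply: xy_inj. Qed.

Lemma lstepE (p q : Defs.point) : lstep p q =
  ((q.1 == p.1 + 1) && (q.2 == p.2)) || ((q.1 == p.1) && (q.2 == p.2 + 1)).
Proof. by case: p q => [a b] [c d]; rewrite /lstep /= !xpair_eqE /=; lia. Qed.

Lemma lstep_edge_point e f : lstep (edge_point e) (edge_point f) = estep e f.
Proof.
have [h1 h2 h3 h4] := edgeP e; have [h1' h2' h3' h4'] := edgeP f.
by rewrite lstepE /estep /edge_point /px /py /=; lia.
Qed.

Lemma path_lstep_bounds (A p : Defs.point) t : path lstep A t -> p \in A :: t ->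
  [/\ A.1 <= p.1, A.2 <= p.2, p.1 <= (last A t).1 & p.2 <= (last A t).2].
Proof.
elim: t A p => [|B t IH] A p /=; first by rewrite inE => _ /eqP ->.
case/andP; rewrite lstepE => AB Bt; rewrite inE => /predU1P[->|Bp].
  by have [b1 b2 b3 b4] := IH B B Bt (mem_head _ _); split; lia.
have [b1 b2 b3 b4] := IH B p Bt Bp; split; lia.
Qed.

Lemma path_lstep_size (A : Defs.point) t : path lstep A t ->
  (last A t).1 + (last A t).2 = A.1 + A.2 + (size t)%:Z.
Proof.
elim: t A => [|B t IH] A /=; first by lia.
by case/andP; rewrite lstepE => AB /IH ->; lia.
Qed.

Lemma path_lstep_uniq (A : Defs.point) t : path lstep A t -> uniq (A :: t).
Proof.
move=> At; pose r : rel Defs.point := [rel p q | p.1 + p.2 < q.1 + q.2].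
apply: (@sorted_uniq _ r) => [p q s /=|p /=|]; [exact: lt_trans|exact: ltxx|].
by apply: sub_path At => p q; rewrite lstepE /r /=; lia.
Qed.

(** Walks that meet continue together, so they have equally many steps left to their first final
    edges, and these coincide. *)
Lemma walk_disjoint (s : {perm edge n}) (k k' : 'I_n) t t' : linked s ->
  (t < 2 * k + 3)%N -> (t' < 2 * k' + 3)%N -> walk s k t = walk s k' t' -> k = k'.
Proof.
move=> sl tk tk' e.
have [b1 nb1] := walk_bot sl k; have [b2 nb2] := walk_bot sl k'.
have D (j : 'I_n) v w : walk s j (v + w) = iter v s (walk s j w) by rewrite /walk iterD.
have H (j j' : 'I_n) v v' : walk s j v = walk s j' v' -> walk s j (2 * j + 2) = bot j ->
    (forall u, (u < 2 * j' + 2)%N -> ~~ ebot (walk s j' u)) -> (v < 2 * j + 3)%N ->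
    (v' < 2 * j' + 3)%N -> (2 * j' + 2 - v' <= 2 * j + 2 - v)%N.
  move=> ee bj nb vj vj'; rewrite leqNgt; apply/negP => lt.
  have := nb (2 * j + 2 - v + v')%N; rewrite D -ee -D subnK; last by lia.
  by rewrite bj ebot_bot => /(_ ltac:(lia)).
have r1 := H _ _ _ _ e b1 nb2 tk tk'.
have r2 := H _ _ _ _ (esym e) b2 nb1 tk' tk.
have : bot k = bot k'.
  rewrite -b1 -b2 -(@subnK t (2 * k + 2)%N); last by lia.
  rewrite -[in RHS](@subnK t' (2 * k' + 2)%N); last by lia.
  by rewrite !D e; congr iter; lia.
by move/(congr1 (@ea n)); rewrite !bot_a => h; apply: ord_inj; lia.
Qed.

Definition path_of (s : {perm edge n}) (k : 'I_n) : seq (edge n) :=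
  traject s (top k) (2 * k + 3).

Lemma path_ofP (s : {perm edge n}) (k : 'I_n) (e : edge n) : reflect (exists2 t, (t <
  2 * k + 3)%N & e = walk s k t) (e \in path_of s k).
Proof. exact: trajectP. Qed.

Definition paths_of (s : {perm edge n}) : n.-tuple (seq Defs.point) :=
  [tuple map edge_point (path_of s (rev_ord i)) | i < n].

Lemma paths_of_in (s : {perm edge n}) : linked s -> path_tuples n (paths_of s).
Proof.
move=> sl; split=> [i|i p|i j ij p].
- rewrite tnth_mktuple; set k := rev_ord i.
  exists (map edge_point (traject s (s (top k)) (2 * k + 2))).
  have <- : edge_point (top k) = Qstart n i.+1.
    by have [h1 h2] := start_edge_xy i; rewrite /edge_point h1 h2.
  rewrite last_map last_traject -/(walk s k _) (walk_bot sl k).1.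
  split.
  + by rewrite /path_of (addnS (2 * k) 2).
  + rewrite path_map; apply/(pathP (top k)) => j; rewrite size_traject => jk /=.
    have -> : nth (top k) (top k :: traject s (s (top k)) (2 * k + 2)) j = walk s k j.
      by rewrite -trajectS; apply: nth_traject; apply: ltnW.
    rewrite (set_nth_default (s (top k))) ?size_traject // nth_traject // -iterSr.
    rewrite lstep_edge_point; apply: link_step => //; first exact: (walk_bot sl k).2.
    exact: walk_moves.
  by have [h1 h2] := end_edge_xy i; rewrite /edge_point h1 h2.
- by rewrite tnth_mktuple => /mapP[e _ ->]; have [] := edge_xyP e.
rewrite !tnth_mktuple => -[/mapP[e /path_ofP[t tk ->] ->] /mapP[f /path_ofP[t' tk'
  ->] /edge_point_inj]].
move/(walk_disjoint sl tk tk')/rev_ord_inj => ij'.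
by rewrite ij' eqxx in ij.
Qed.

(** By [on_walk] every moved edge is on a path; the path records its image, except at the last edge,
    which returns to the start. *)
Lemma paths_of_inj : {in linked_perms n &, injective paths_of}.
Proof.
suff H (s s' : {perm edge n}) e : linked s -> linked s' -> paths_of s = paths_of s' ->
    s e != e -> s e = s' e.
  move=> s s'; rewrite !inE => sl sl' ss; apply/permP => e.
  have [se|ne] := eqVneq (s e) e; last exact: H sl sl' ss ne.
  have [s'e|ne] := eqVneq (s' e) e; first by rewrite se s'e.
  exact: esym (H _ _ _ sl' sl (esym ss) ne).
move=> sl sl' ss se; have [k [t [tk ->]]] := on_walk sl se.
have pk : path_of s k = path_of s' k.
  apply: (inj_map edge_point_inj); have := congr1 (fun Q => tnth Q (rev_ord k)) ss.
  by rewrite !tnth_mktuple rev_ordK.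
have W u : (u < 2 * k + 3)%N -> walk s k u = walk s' k u.
  move=> uk; rewrite /walk -(nth_traject s uk) -(nth_traject s' uk).
  by rewrite -/(path_of s k) pk.
rewrite [in RHS]W // -[s _]/(walk s k t.+1) -[s' _]/(walk s' k t.+1).
have [tk'|tk'] := leqP (2 * k + 2)%N t; last by apply: W; lia.
have -> : t.+1 = (2 * k + 3)%N by lia.
by rewrite !walk_period.
Qed.

(** The box spanned by the two ends of a path and the line [y = x + n] confine its points to the
    range of [edge_point]. *)
Lemma tuple_edges (Q : n.-tuple (seq Defs.point)) (i : 'I_n) : path_tuples n Q ->
  exists q : seq (edge n), tnth Q i = map edge_point q.
Proof.
move=> [Ql Qa _]; have [t [eQ At Bt]] := Ql i.
have : forall p, p \in tnth Q i -> exists e : edge n, p = edge_point e.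
  move=> p pQ; have := Qa i p pQ; rewrite eQ in pQ.
  have := path_lstep_bounds At pQ; rewrite Bt /Qstart /Qend /= => -[b1 b2 b3 b4] w.
  case: p {pQ} b1 b2 b3 b4 w => x y /= b1 b2 b3 b4 w; have hi := ltn_ord i.
  have [a ea_] : exists a : nat, x + 2 * y - 2 * n%:Z + 2 = a%:Z.
    by exists (absz (x + 2 * y - 2 * n%:Z + 2)%R); lia.
  have [b eb_] : exists b : nat, 2 * n%:Z + 2 - x + y = b%:Z.
    by exists (absz (2 * n%:Z + 2 - x + y)%R); lia.
  have [e e1 e2] : {e : edge n | ea e = a & eb e = b} by apply: edge_ex; lia.
  exists e; rewrite /edge_point /px /py e1 e2; congr pair; lia.
elim: (tnth Q i) => [|p s IH] h; first by exists [::].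
have [e ->] := h p (mem_head _ _).
have [q ->] := IH (fun r rs => h r (mem_behead (s := p :: s) rs)).
by exists (e :: q).
Qed.

Section Surjective.
Variable Q : n.-tuple (seq Defs.point).
Hypothesis QP : path_tuples n Q.

Let q (i : 'I_n) : seq (edge n) := projT1 (cid (tuple_edges i QP)).
Let qE i : tnth Q i = map edge_point (q i).
Proof. by rewrite /q; case: cid. Qed.

Let q_path i : exists t, [/\ q i = start_edge i :: t, path (@estep n) (start_edge i) t,
  last (start_edge i) t = end_edge i & size t = (2 * (rev_ord i) + 2)%N].
Proof.
have [Ql _ _] := QP; have [t [eQ At Bt]] := Ql i; move: eQ; rewrite qE.
case: (q i) => // e u /eqP; rewrite /= eqseq_cons => /andP[/eqP ee /eqP ut].
have ei : e = start_edge i by apply: edge_point_inj; rewrite ee /edge_point; have [->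
  ->] := start_edge_xy i.
subst e t; exists u; split=> //.
- by move: At; rewrite -ee path_map; apply: sub_path => a b /=; rewrite
  lstep_edge_point.
- apply: edge_point_inj; rewrite -last_map ee Bt /edge_point; by have [-> ->] :=
  end_edge_xy i.
have := path_lstep_size At; rewrite Bt /Qstart /Qend size_map /=.
by have := ltn_ord i; lia.
Qed.

Let q_uniq i : uniq (q i).
Proof.
have [Ql _ _] := QP; have [t [eQ At Bt]] := Ql i.
by rewrite -(map_inj_uniq edge_point_inj) -qE eQ path_lstep_uniq.
Qed.

Let q_disj i j e : e \in q i -> e \in q j -> i = j.
Proof.
have [_ _ Qd] := QP => ei ej; apply/eqP; apply: contraT => ij.
by case: (Qd i j ij (edge_point e)); rewrite !qE !mem_map //; apply: edge_point_inj.
Qed.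

Let q_cycle i : path.cycle (@elink n) (q i).
Proof.
have [t [-> At Bt _]] := q_path i.
have BT : elink (end_edge i) (start_edge i) by rewrite /elink ebot_bot etop_top top_b
  bot_b eqxx.
rewrite /= rcons_path Bt BT andbT.
apply: sub_path At => e f ef; have [h1 h2 h3 h4] := edgeP f; rewrite /elink.
have -> : ebot e = false by apply/negbTE; move: ef; rewrite /ebot /estep; lia.
by rewrite ef orbT andbT; move: ef; rewrite /etop /estep; lia.
Qed.

(** The inverse construction: each path is closed up into a cycle and all other edges are fixed. *)
Let g e := if [pick i | e \in q i] is Some i then next (q i) e else e.

Let gE i e : e \in q i -> g e = next (q i) e.
Proof.
by move=> ei; rewrite /g; case: pickP => [j /q_disj/(_ ei) ->|/(_ i)]; rewrite ?ei.
Qed.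

Let gE0 e : (forall i, e \notin q i) -> g e = e.
Proof. by move=> h; rewrite /g; case: pickP => // i; rewrite (negPf (h i)). Qed.

Let q_case e : (exists i, e \in q i) \/ (forall i, e \notin q i).
Proof.
case: (boolP [exists i, e \in q i]) => [/existsP|]; first by left.
by rewrite negb_exists => /forallP; right.
Qed.

Let g_inj : injective g.
Proof.
move=> e f; case: (q_case e) => [[i ei]|ne]; case: (q_case f) => [[j fj]|nf].
- rewrite (gE ei) (gE fj) => ef.
  have ij : i = j by apply: (@q_disj i j (next (q i) e)); [rewrite mem_next|rewrite
    ef mem_next].
  by subst j; rewrite -(prev_next (q_uniq i) e) ef prev_next.
- by rewrite (gE ei) (gE0 nf) => ef; have := nf i; rewrite -ef mem_next ei.
- by rewrite (gE0 ne) (gE fj) => ef; have := ne j; rewrite ef mem_next fj.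
by rewrite (gE0 ne) (gE0 nf).
Qed.

Lemma paths_of_surj : exists2 s, s \in linked_perms n & paths_of s = Q.
Proof.
have sl : linked (perm g_inj).
  apply/forallP => e; rewrite permE; case: (q_case e) => [[i ei]|ne].
    by rewrite (gE ei) next_cycle.
  (* All initial and final edges are on the paths, so an edge off the paths may be fixed. *)
  rewrite (gE0 ne) /elink.
  have -> : ebot e = false.
    apply/negP => /ebotP[k ek]; have [t [qk _ lt _]] := q_path (rev_ord k).
    have := ne (rev_ord k); rewrite qk ek.
    by have := mem_last (start_edge (rev_ord k)) t; rewrite lt /end_edge rev_ordK => ->.
  rewrite eqxx andbT; apply/negP => /etopP[k ek]; have [t [qk _ _ _]] := q_path
    (rev_ord k).
  by have := ne (rev_ord k); rewrite qk ek /start_edge rev_ordK mem_head.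
exists (perm g_inj); first by rewrite inE.
apply: eq_from_tnth => i; rewrite tnth_mktuple qE; congr map.
have [t [qi _ _ st]] := q_path i.
have : fcycle (perm g_inj) (q i).
  rewrite -(@eq_in_cycle _ (mem (q i)) (frel (next (q i)))).
  - exact: cycle_next.
  - by move=> e f ei fi; rewrite /= permE (gE ei).
  by apply/allP.
rewrite qi /= rcons_path => /andP[/fpathE -> _].
by rewrite st /path_of (addnS (2 * rev_ord i) 2).
Qed.
End Surjective.

Lemma card_path_tuples : path_tuples n #= `I_#|linked_perms n|.
Proof.
apply: (card_eq_bij paths_of_inj) => [s|Q].
  by rewrite inE; apply: paths_of_in.
exact: paths_of_surj.
Qed.
End Paths.

Unset Implicit Arguments.

Theorem corollary1p5 (R : realType) (n : nat) (hn : (0 < n)%N) :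
  exists T : nat,
    [/\ lozenge_tilings n #= `I_T,
        path_tuples n #= `I_T,
        \det (Dmx n) = T%:Z
      & T%:R =
        \prod_(1 <= a < 3 * n + 3)
         \prod_(1 <= b < 3 * n + 3 |
                (a < b)%N && ((a, b) != (n + 1, 2 * n + 2)%N))
           modulus (1 + zeta R n ^+ a + zeta R n ^+ b) `^ (3%:R^-1) :> R].
Proof.
exists #|linked_perms n|; split.
- exact: card_lozenge_tilings.
- exact: card_path_tuples.
- exact: det_Dmx.
by apply: count_formula; apply: det_elink_count.
Qed.
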